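(* A viscoelastic model represented by a spring-dashpot network is globally identifiable if and only if it is locally identifiable and the network can be constructed by adding, either in parallel or in series at the bounding nodes, exactly one basic element (spring or dashpot) at a time; that is, there is a sequence of networks $M_1,\dots,M_r$ with $M_1$ a basic element, $M_r$ the given network, and for each $i<r$ either $M_{i+1}=M_i\lor b_i$ or $M_{i+1}=M_i\land b_i$ for some basic element $b_i$.
   Context: Spring-dashpot networks. A spring with constant $E$ (relation $E\epsilon=\sigma$ between strain $\epsilon$ and stress $\sigma$) and a dashpot with constant $\eta$ (relation $\eta\dot\epsilon=\sigma$) are networks (the basic elements). If $N_1,N_2$ are networks with disjoint sets of parameters, their parallel connection $N_1\lor N_2$ and series connection $N_1\land N_2$ are networks; all networks arise in this way. The operations $\lor$ and $\land$ are each regarded as commutative and associative (equality of networks is up to these rules). Constitutive equation. Each network has a constitutive equation $L\epsilon=L'\sigma$, where $L,L'$ are linear differential operators, viewed as polynomials in $x=d/dt$, whose coefficients are functions of the parameters $E_j,\eta_k$. For basic elements it is given above. If $N_1,N_2$ have constitutive equations $L_1\epsilon_1=L_2\sigma_1$ and $L_3\epsilon_2=L_4\sigma_2$, then $N_1\land N_2$ has constitutive equation $L_1L_3\epsilon=(L_1L_4+L_2L_3)\sigma$ divided by $\gcd(L_1,L_3)$ (stresses equal, strains add), and $N_1\lor N_2$ has constitutive equation $(L_1L_4+L_2L_3)\epsilon=L_2L_4\sigma$ divided by $\gcd(L_2,L_4)$ (strains equal, stresses add). Parameters are treated as independent indeterminates, so gcds are taken over the field of rational functions in the parameters, and a coefficient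 is nonzero if it is not identically zero. The equation is normalized by dividing through so that the leading coefficient on one chosen side ($\epsilon$ or $\sigma$) equals $1$. The non-monic coefficients are the remaining nonzero coefficients on both sides; $d$ is their number, and $\mathbf c$ is the vector of them. Identifiability. For a network with $N$ springs and $K$ dashpots and parameter space $\Theta=\mathbb R_{>0}^{N+K}$, regard $\mathbf c$ as a map $\mathbf c:\Theta\to\mathbb R^d$. The model is globally identifiable if $\mathbf c$ is one-to-one and locally identifiable if $\mathbf c$ is finite-to-one. These notions are meant generically: for almost every $\theta\in\Theta$ the fiber $\mathbf c^{-1}(\mathbf c(\theta))$ is, respectively, a single point, finite. *)

(* Defs.v *)
From mathcomp Require Import all_boot all_order all_algebra.
From mathcomp Require Import all_classical all_reals all_analysis.
(* The notations of mpoly.v clash with those of MathComp-Analysis; [mpoly n R]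
   is the polynomial ring R[X_0, .., X_(n-1)]. *)
From mathcomp Require Import -(notations) mpoly.

Set Implicit Arguments.
Unset Strict Implicit.
Unset Printing Implicit Defensive.

Import Order.TTheory GRing.Theory Num.Theory.
Import numFieldNormedType.Exports.

Local Open Scope classical_set_scope.
Local Open Scope ring_scope.

(* The available parameters are E_0, .., E_(N-1) and eta_0, .., eta_(K-1). *)
Inductive network (N K : nat) : Type :=
| Spring of 'I_N
| Dashpot of 'I_K
| Par of network N K & network N K
| Ser of network N K & network N K.

Arguments Spring {N K}.
Arguments Dashpot {N K}.

Section Networks.
Variables N K : nat.
Implicit Types M A B C : network N K.

Definition is_basic M : bool :=
  match M with Spring _ | Dashpot _ => true | _ => false end.

Fixpoint params M : seq ('I_N + 'I_K) :=
  match M with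
  | Spring j => [:: inl j]
  | Dashpot k => [:: inr k]
  | Par A B | Ser A B => params A ++ params B
  end.

(* Connected networks have disjoint sets of parameters, i.e., no parameter
   occurs twice in the tree. *)
Definition is_network M : bool := uniq (params M).

Inductive net_eq : network N K -> network N K -> Prop :=
| net_refl A : net_eq A A
| net_sym A B : net_eq A B -> net_eq B A
| net_trans A B C : net_eq A B -> net_eq B C -> net_eq A C
| net_par A A' B B' :
    net_eq A A' -> net_eq B B' -> net_eq (Par A B) (Par A' B')
| net_ser A A' B B' :
    net_eq A A' -> net_eq B B' -> net_eq (Ser A B) (Ser A' B')
| net_parC A B : net_eq (Par A B) (Par B A)
| net_serC A B : net_eq (Ser A B) (Ser B A)
| net_parA A B C : net_eq (Par A (Par B C)) (Par (Par A B) C)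
| net_serA A B C : net_eq (Ser A (Ser B C)) (Ser (Ser A B) C).

(* The sequence is Ms 1, .., Ms r. *)
Definition one_at_a_time M : Prop :=
  exists (r : nat) (Ms : nat -> network N K),
    [/\ (0 < r)%N,
        is_basic (Ms 1%N),
        net_eq (Ms r) M,
        (forall i, (0 < i <= r)%N -> is_network (Ms i)) &
        (forall i, (0 < i < r)%N -> exists b : network N K,
           is_basic b /\
           (net_eq (Ms i.+1) (Par (Ms i) b) \/
            net_eq (Ms i.+1) (Ser (Ms i) b)))].

End Networks.

Section ConstitutiveEquation.
Variables (R : realType) (N K : nat).

Local Notation F := {fraction (mpoly (N + K) R)}.

(* E_j is the indeterminate X_j and eta_k the indeterminate X_(N + k). *)
Definition param_var (p : 'I_N + 'I_K) : F :=
  tofrac (mpolyX R (mnm1 (unsplit p))).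

(* The pair (L, L') stands for L epsilon = L' sigma; the variable 'X is d/dt.
   [gcdp] is a gcd up to a nonzero scalar, so the equation is determined up to
   a common nonzero scalar, which the normalization below removes. *)
Fixpoint constitutive (M : network N K) : {poly F} * {poly F} :=
  match M with
  | Spring j => ((param_var (inl j))%:P, 1)
  | Dashpot k => (param_var (inr k) *: 'X, 1)
  | Ser A B =>
      let: (L1, L2) := constitutive A in
      let: (L3, L4) := constitutive B in
      let g := gcdp L1 L3 in
      ((L1 * L3) %/ g, (L1 * L4 + L2 * L3) %/ g)
  | Par A B =>
      let: (L1, L2) := constitutive A in
      let: (L3, L4) := constitutive B in
      let g := gcdp L2 L4 in
      ((L1 * L4 + L2 * L3) %/ g, (L2 * L4) %/ g)
  end.

End ConstitutiveEquation.

Inductive side := Strain | Stress.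

Section Coefficients.
Variables (R : realType) (N K : nat).

Local Notation F := {fraction (mpoly (N + K) R)}.

Definition on_side (s : side) (e : {poly F} * {poly F}) : {poly F} :=
  if s is Strain then e.1 else e.2.

Definition off_side (s : side) (e : {poly F} * {poly F}) : {poly F} :=
  if s is Strain then e.2 else e.1.

Definition normalized (s : side) (M : network N K) : {poly F} * {poly F} :=
  let e := constitutive R M in
  let u := lead_coef (on_side s e) in
  (u^-1 *: e.1, u^-1 *: e.2).

Definition nonmonic_coefs (s : side) (M : network N K) : seq F :=
  let P := on_side s (normalized s M) in
  let Q := off_side s (normalized s M) in
  [seq a <- take (size P).-1 P ++ Q | a != 0].

End Coefficients.

(* The value at theta of a rational function defined at theta: it is computed
   from any representation p / q with q(theta) <> 0, and does not depend on the
   representation (junk value 0 if there is none). *)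
Definition frac_eval (R : realType) (n : nat) (theta : n.-tuple R)
    (f : {fraction (mpoly n R)}) : R :=
  xget 0 [set v | exists p q : mpoly n R,
    [/\ meval (tnth theta) q != 0,
        f = tofrac p / tofrac q &
        v = meval (tnth theta) p / meval (tnth theta) q]].

(* Lebesgue measure on (the Borel sets of) R^n, as an iterated product measure
   transported along R * R^m = R^(m+1). *)
Fixpoint lebesgue_tuple (R : realType) (n : nat) :
    set (n.-tuple (measurableTypeR R)) -> \bar R :=
  match n with
  | 0%N => dirac ([tuple] : 0.-tuple (measurableTypeR R))
  | m.+1 => fun A => (@lebesgue_measure R \x @lebesgue_tuple R m)%E
      ((fun xt : measurableTypeR R * m.-tuple (measurableTypeR R) =>
          cons_tuple xt.1 xt.2) @^-1` A)
  end.

Section Identifiability.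
Variables (R : realType) (N K : nat) (s : side) (M : network N K).

Definition Theta : set ((N + K).-tuple R) :=
  [set theta | forall i, 0 < tnth theta i].

Definition coef_map (theta : (N + K).-tuple R) :
    (size (nonmonic_coefs R s M)).-tuple R :=
  map_tuple (frac_eval theta) (in_tuple (nonmonic_coefs R s M)).

Definition fiber (theta : (N + K).-tuple R) : set ((N + K).-tuple R) :=
  [set theta' | Theta theta' /\ coef_map theta' = coef_map theta].

Definition globally_identifiable : Prop :=
  {ae @lebesgue_tuple R (N + K),
     forall theta, Theta theta -> fiber theta = [set theta]}.

Definition locally_identifiable : Prop :=
  {ae @lebesgue_tuple R (N + K),
     forall theta, Theta theta -> finite_set (fiber theta)}.

End Identifiability.

(* Main.v *)
Require Import Defs.
From mathcomp Require Import all_boot all_order all_algebra.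
From mathcomp Require Import all_classical all_reals all_analysis.
From mathcomp Require Import -(notations) mpoly.
From mathcomp Require Import complex zify ring lra.

(* The compliance [J = L' / L] of a network is a Stieltjes function
   [c + \sum_y r_y / (x - y)] with [c >= 0], poles [y <= 0] and residues
   [r_y > 0]. Series connection adds compliances, and [J |-> 1 / (x J)], which
   exchanges series and parallel connection, preserves Stieltjes functions. The
   spectral type of [J] consists of the number [n] of its nonzero poles and of
   two flags: [c > 0], and whether [0] is a pole.

   Let [A] and [B] be networks for which the parameters correspond bijectively to
   the Stieltjes functions of a given type. If both have a constant term, or both
   a pole at [0], a part of it can be moved from one to the other, so all fibers
   of the series connection are infinite. If both have a nonzero pole, exchanging
   two poles gives a second point in every fiber. Otherwise one of them has no
   nonzero pole, hence is an element or a spring in series with a dashpot; then it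
   can be added one element at a time, and the connection again corresponds
   bijectively to the functions of some type. By induction a network is either
   one-at-a-time with injective coefficient map or has no singleton fiber, and a
   one-at-a-time network has all its fibers singletons or all infinite. These
   alternatives hold at every point of [Theta], so measure enters only through the
   fact that [Theta] is not negligible.

   For generic parameters the gcd in the constitutive equation is [1] or [x]:
   scaling the dashpots of one subnetwork moves its zeros away from those of the
   other. *)

Set Implicit Arguments.
Unset Strict Implicit.
Unset Printing Implicit Defensive.

Import Order.TTheory GRing.Theory Num.Theory.

(** * Partial fractions and Stieltjes functions *)

Section PartialFractions.
Local Open Scope ring_scope.
Variable R : comNzRingType.
Implicit Types (c : R) (s : seq (R * R)).

Definition den s : {poly R} := \prod_(t <- s) ('X - t.1%:P).

(* [num c s / den s] is [c + \sum_(t <- s) t.2 / ('X - t.1)]. *)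
Fixpoint num c s : {poly R} :=
  if s is t :: s' then ('X - t.1%:P) * num c s' + t.2%:P * den s' else c%:P.

Lemma den_cons t s : den (t :: s) = ('X - t.1%:P) * den s.
Proof. exact: big_cons. Qed.

Lemma den_cat s1 s2 : den (s1 ++ s2) = den s1 * den s2.
Proof. exact: big_cat. Qed.

Lemma den_perm s1 s2 : perm_eq s1 s2 -> den s1 = den s2.
Proof. exact: perm_big. Qed.

Lemma denE s : den s = \prod_(y <- unzip1 s) ('X - y%:P).
Proof. by rewrite big_map. Qed.

Lemma num_cat c s1 s2 :
  num c (s1 ++ s2) = num 0 s1 * den s2 + den s1 * num c s2.
Proof.
elim: s1 => [|t s1 IH] /=.
  by rewrite polyC0 /den big_nil mul0r add0r mul1r.
by rewrite IH den_cons den_cat; ring.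
Qed.

Lemma num_shift c e s : num (c + e) s = num c s + e%:P * den s.
Proof.
elim: s => [|t s IH] /=; first by rewrite /den big_nil mulr1 polyCD.
by rewrite IH den_cons; ring.
Qed.

(** Adding two partial fractions adds the constants and concatenates the pole lists, also when poles
    coincide; the right-hand side is the numerator of a series connection before a common [x] is
    removed. *)
Lemma num_add c1 c2 s1 s2 :
  num (c1 + c2) (s2 ++ s1) = den s1 * num c2 s2 + num c1 s1 * den s2.
Proof.
have E c s : num c s = num 0 s + c%:P * den s by rewrite -num_shift add0r.
by rewrite num_cat (E (c1 + c2)) (E c2 s2) (E c1 s1) polyCD; ring.
Qed.

Lemma num_perm c s1 s2 : perm_eq s1 s2 -> num c s1 = num c s2.
Proof.
apply: catCA_perm_subst => {}s1 {}s2 s3.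
by rewrite !num_cat !den_cat; ring.
Qed.

Lemma size_den s : size (den s) = (size s).+1.
Proof. by rewrite /den size_prod_XsubC. Qed.

Lemma monic_den s : den s \is monic.
Proof. exact: monic_prod_XsubC. Qed.

Lemma size_num0 s : (size (num 0 s) <= size s)%N.
Proof.
elim: s => [|t s IH] /=; first by rewrite size_poly0.
rewrite (leq_trans (size_polyD _ _)) // geq_max; apply/andP; split.
  by rewrite (leq_trans (size_polyMleq _ _)) // size_XsubC.
rewrite mul_polyC (leq_trans (size_scale_leq _ _)) //.
by rewrite size_den.
Qed.

Lemma size_num c s : (size (num c s) <= (size s).+1)%N.
Proof.
rewrite -[c]add0r num_shift (leq_trans (size_polyD _ _)) // geq_max.
rewrite (leq_trans (size_num0 s)) //= mul_polyC.
by rewrite (leq_trans (size_scale_leq _ _)) // size_den.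
Qed.

(** The constant is the value at infinity: [den s] is monic and [num 0 s] has smaller degree. *)
Lemma coef_num c s : (num c s)`_(size s) = c.
Proof.
rewrite -[c in LHS]add0r num_shift coefD nth_default ?size_num0 // add0r coefCM.
by have /monicP := monic_den s; rewrite lead_coefE size_den /= => ->; rewrite mulr1.
Qed.

Lemma coef_num0 s : s != [::] -> (num 0 s)`_(size s).-1 = \sum_(t <- s) t.2.
Proof.
elim: s => // t s IH _ /=; rewrite big_cons coefD coefCM.
have -> : (den s)`_(size s) = 1.
  by have /monicP := monic_den s; rewrite lead_coefE size_den.
rewrite mulr1 addrC; congr (_ + _); case: s IH => [_|u s IH].
  by rewrite /= polyC0 mulr0 coef0 big_nil.
rewrite -IH // mulrBl coefB coefXM /= coefCM.
by rewrite [X in _ - _ * X]nth_default ?mulr0 ?subr0 // (size_num0 (u :: s)).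
Qed.

End PartialFractions.

(** * Residues and partial fraction decomposition over a field *)

Section Residues.
Local Open Scope ring_scope.
Variable F : fieldType.
Implicit Types (c : F) (s : seq (F * F)).

Lemma root_den s x : root (den s) x = (x \in unzip1 s).
Proof. by rewrite denE root_prod_XsubC. Qed.

(** At a simple pole only the term of that pole survives in the numerator, multiplied by the product
    of the other factors of [den s]. *)
Lemma num_residue c s t : uniq (unzip1 s) -> t \in s ->
  (num c s).[t.1] = t.2 * (den s)^`().[t.1].
Proof.
elim: s => //= u s IH /andP[us Us]; rewrite inE den_cons.
rewrite derivM derivXsubC mul1r !hornerD !hornerM hornerC !hornerXsubC.
case/predU1P=> [->|ts]; first by rewrite subrr !mul0r add0r addr0.
have /rootP -> : root (den s) t.1 by rewrite root_den map_f.
by rewrite (IH Us ts); ring.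
Qed.

Lemma uniq_deriv_prod (l : seq F) :
  {in l, forall q, (\prod_(y <- l) ('X - y%:P))^`().[q] != 0} -> uniq l.
Proof.
elim: l => //= q l IH lP.
have rl y : y \in l -> (\prod_(y <- l) ('X - y%:P)).[y] = 0.
  by move=> yl; apply/rootP; rewrite root_prod_XsubC.
have dE y : (\prod_(y <- q :: l) ('X - y%:P))^`().[y] =
    (\prod_(y <- l) ('X - y%:P)).[y] + (y - q) * (\prod_(y <- l) ('X - y%:P))^`().[y].
  by rewrite big_cons derivM derivXsubC mul1r hornerD hornerM hornerXsubC.
apply/andP; split.
  apply/negP => ql; have := lP q (mem_head _ _).
  by rewrite dE rl // subrr mul0r addr0 eqxx.
apply: IH => y yl; have := lP y; rewrite inE yl orbT => /(_ isT).
by rewrite dE rl // add0r mulf_eq0 => /norP[].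
Qed.

(** The residue [r] at [t] is chosen so that [W - r%:P * d] vanishes at [t]; the quotient by
    ['X - t%:P] is decomposed over the remaining poles. *)
Lemma partial_fractions (T : seq F) (W : {poly F}) :
  uniq T -> (size W <= (size T).+1)%N ->
  exists2 s, unzip1 s = T & W = num W`_(size T) s.
Proof.
elim: T W => [W _ /size1_polyC eW|t T IH W /= /andP[tT UT] sW].
  by exists [::].
pose d : {poly F} := \prod_(y <- T) ('X - y%:P).
have dt : d.[t] != 0 by have := root_prod_XsubC T t; rewrite /root => ->.
have sd : size d = (size T).+1 by rewrite size_prod_XsubC.
pose r := W.[t] / d.[t].
have /factor_theorem[W' eW'] : root (W - r%:P * d) t.
  by rewrite rootE hornerD hornerN hornerM hornerC divfK // subrr.
have eW : W = W' * ('X - t%:P) + r%:P * d by rewrite -eW' subrK.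
have sW' : (size W' <= (size T).+1)%N.
  have [->|W'0] := eqVneq W' (0 : {poly F}); first by rewrite size_poly0.
  have : (size (W' * ('X - t%:P))%R <= (size T).+2)%N.
    rewrite -eW' (leq_trans (size_polyD _ _)) // geq_max sW /= size_polyN.
    by rewrite mul_polyC (leq_trans (size_scale_leq _ _)) // sd.
  by rewrite size_Mmonic ?monicXsubC // size_XsubC addn2 /= ?ltnS.
have [s us es] := IH W' UT sW'.
exists ((t, r) :: s); first by rewrite /= us.
have -> : W`_(size T).+1 = W'`_(size T).
  rewrite eW coefD coefCM [d`__]nth_default ?sd // mulr0 addr0.
  rewrite mulrBr coefB coefMX coefMC [W'`_(_.+1)]nth_default //.
  by rewrite mul0r subr0.
by rewrite /= -es [LHS]eW denE us; congr (_ + _); rewrite mulrC.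
Qed.

End Residues.

(** * Signs, and the location of the zeros of a Stieltjes function *)

Section Stieltjes.
Local Open Scope ring_scope.
Variable R : rcfType.
Implicit Types (c : R) (s : seq (R * R)).

Definition pos_residues s := all (fun t : R * R => 0 < t.2) s.

Definition nonpos_poles s := all (fun t : R * R => t.1 <= 0) s.

(* For [J = p / q] this is [- J' * q ^ 2]. *)
Definition wronskian (p q : {poly R}) := p * q^`() - p^`() * q.

Lemma wronskian_num c t s :
  wronskian (num c (t :: s)) (den (t :: s)) =
  ('X - t.1%:P) ^+ 2 * wronskian (num c s) (den s) + t.2%:P * den s ^+ 2.
Proof. rewrite /wronskian den_cons /= derivD !derivM derivXsubC derivC; ring. Qed.

(** The derivative satisfies -J' = sum of r_y / (x - y)^2, which is positive away from the poles; at
    a pole, multiplication by q^2 leaves the positive contribution of that pole. *)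
Lemma wronskian_gt0 c s x : uniq (unzip1 s) -> pos_residues s -> s != [::] ->
  0 < (wronskian (num c s) (den s)).[x].
Proof.
elim: s => // t s IH /= /andP[ts Us] /andP[t0 s0] _.
rewrite wronskian_num !expr2 hornerD !hornerM hornerXsubC hornerC -!expr2.
have ds : 0 <= t.2 * (den s).[x] ^+ 2 by rewrite mulr_ge0 ?sqr_ge0 ?ltW.
have [xt|xt] := eqVneq x t.1.
  rewrite xt subrr expr0n mul0r add0r mulr_gt0 //.
  by rewrite lt0r sqr_ge0 sqrf_eq0 -/(root _ _) root_den ts.
case: s IH ts Us s0 ds => [|u s] IH ts Us s0 ds.
  rewrite /wronskian /= /den big_nil -polyC1 !derivC mulr0 mul0r subrr.
  by rewrite horner0 mulr0 add0r hornerC expr1n mulr1.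
apply: ltr_wpDr => //; apply: mulr_gt0; last exact: IH.
by rewrite lt0r sqr_ge0 sqrf_eq0 subr_eq0 xt.
Qed.

Lemma num_gt0 c s x : 0 <= c -> pos_residues s -> (s != [::]) || (c != 0) ->
  all (fun t => t.1 < x) s -> 0 < (num c s).[x].
Proof.
move=> c0; elim: s => [_|t s IH] /=; first by rewrite hornerC lt0r c0 andbT.
move=> /andP[t0 s0] _ /andP[tx sx]; rewrite !hornerE.
have dx : 0 < (den s).[x].
  elim: s {IH s0} sx => [|u s IH] /=; first by rewrite /den big_nil hornerC.
  by case/andP=> ux sx; rewrite den_cons !hornerE mulr_gt0 ?subr_gt0 // IH.
have nx : 0 <= (num c s).[x].
  have [nz|] := boolP ((s != [::]) || (c != 0)); first exact: ltW (IH _ _ _).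
  by rewrite negb_or !negbK => /andP[/eqP-> /eqP->]; rewrite /= hornerC.
have tx' : 0 < x - t.1 by rewrite subr_gt0.
have := mulr_ge0 (ltW tx') nx; have := mulr_gt0 t0 dx; lra.
Qed.

(** For [c = 0] the next coefficient is the sum of the residues, whose positivity prevents a further
    drop of the degree. *)
Lemma size_num_eq c s : 0 <= c -> pos_residues s ->
  size (num c s) = (size s + (c != 0%R))%N /\
  ((s != [::]) || (c != 0) -> 0 < lead_coef (num c s)).
Proof.
move=> c0 s0; have [->|cn] := eqVneq c (0 : R); last first.
  have szn : size (num c s) = (size s + 1)%N.
    apply/eqP; rewrite eqn_leq addn1 size_num /= ltnNge; apply/negP => le.
    by move: cn; rewrite -(coef_num c s) nth_default ?eqxx.
  by split=> // _; rewrite lead_coefE szn addn1 coef_num lt0r cn.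
case: s s0 => [|t s] s0; first by rewrite /= size_poly0; split.
have : 0 < (num 0 (t :: s))`_(size (t :: s)).-1.
  rewrite coef_num0 // big_cons; move: s0 => /= /andP[t0 s0].
  by rewrite ltr_wpDr // big_seq sumr_ge0 // => u /(allP s0) /ltW.
move=> l0; have szn : size (num 0 (t :: s)) = (size (t :: s) + 0)%N.
  apply/eqP; rewrite eqn_leq addn0 size_num0 ltnNge; apply/negP => le.
  by move: l0; rewrite nth_default ?ltxx // -ltnS.
by split=> // _; rewrite lead_coefE szn addn0.
Qed.

Local Notation toC := (real_complex R).

(* With [J = num c s / den s], this says that [Im J(z)] and [Im z] have opposite
   signs. *)
Lemma num_den_conj c s (z : R[i]) : pos_residues s -> s != [::] -> z^*%C != z ->
  exists2 S : R[i], 0 < S &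
  (map_poly toC (num c s)).[z] * ((map_poly toC (den s)).[z])^*%C
    - ((map_poly toC (num c s)).[z])^*%C * (map_poly toC (den s)).[z]
  = (z^*%C - z) * S.
Proof.
move=> + + zn; elim: s => // t s IH /= /andP[t0 s0] _.
have tC : 0 < toC t.2 by rewrite ltcR.
have tJ : (toC t.2)^*%C = toC t.2 by rewrite conjc_real.
have yJ : (toC t.1)^*%C = toC t.1 by rewrite conjc_real.
rewrite den_cons !rmorphD !rmorphM !rmorphB /= map_polyX !map_polyC /=.
rewrite !hornerD !hornerM !hornerXsubC !hornerC.
set N := (map_poly _ (num _ _)).[z] in IH *.
set D := (map_poly _ (den _)).[z] in IH *.
(* [D] vanishes only at the poles, which are real, whereas [z] is not. *)
have D0 : D != 0.
  apply/negP => /eqP/rootP; rewrite /den rmorph_prod /=.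
  under eq_bigr do rewrite rmorphB /= map_polyX map_polyC /=.
  rewrite -(big_map (fun u : R * R => toC u.1) xpredT (fun y => 'X - y%:P)).
  rewrite root_prod_XsubC => /mapP[u _ zu].
  by move: zn; rewrite zu conjc_real eqxx.
have DD : 0 < D * D^*%C by rewrite lt0r mulf_neq0 ?conjc_eq0 // mulcJ_ge0.
have cM (a b : R[i]) : conjc (a * b) = conjc a * conjc b by exact: rmorphM.
have cD (a b : R[i]) : conjc (a + b) = conjc a + conjc b by exact: rmorphD.
have cB (a b : R[i]) : conjc (a - b) = conjc a - conjc b by exact: rmorphB.
rewrite !(cM, cB, cD) tJ yJ.
set w := toC t.1; have ww : 0 <= (z - w) * (z^*%C - w).
  by have := mulcJ_ge0 (z - w); rewrite cB yJ.
have [S S0 eS] : exists2 S : R[i], 0 <= S & N * D^*%C - N^*%C * D = (z^*%C - z) * S.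
  have [s00|sn] := eqVneq s [::]; last first.
    by have [//|//|S /ltW S0 eS] := IH; exists S.
  exists 0 => //; rewrite /N /D /den s00 /= big_nil map_polyC /= hornerC.
  by rewrite rmorph1 hornerC !conjc_real; ring.
(* The first summand is |z - w|^2 times the contribution of the tail; the second, the residue times
   |D|^2, is that of the new term. *)
exists ((z - w) * (z^*%C - w) * S + toC t.2 * (D * D^*%C)).
  by apply: ltr_wpDl; [exact: mulr_ge0 | exact: mulr_gt0].
have -> : (z^*%C - z) * ((z - w) * (z^*%C - w) * S + toC t.2 * (D * D^*%C)) =
   (z - w) * (z^*%C - w) * ((z^*%C - z) * S) + (z^*%C - z) * toC t.2 * (D * D^*%C).
  by ring.
by rewrite -eS; ring.
Qed.

(** A nonreal zero of the numerator would contradict [num_den_conj], a double zero the positivity of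
    the wronskian, and a nonnegative zero the positivity of the numerator to the right of all
    poles. *)
Lemma num_split c s : 0 <= c -> uniq (unzip1 s) -> pos_residues s ->
  (s != [::]) || (c != 0) -> nonpos_poles s ->
  exists qs : seq R,
   [/\ num c s = lead_coef (num c s) *: \prod_(q <- qs) ('X - q%:P),
       uniq qs & all (fun q => q < 0) qs].
Proof.
move=> c0 Us s0 nz sle; set Q := num c s.
have [_ /(_ nz) lQ] := size_num_eq c0 s0; rewrite -/Q in lQ.
have [s00|sn] := eqVneq s [::].
  by exists [::]; split=> //; rewrite big_nil /Q s00 /= lead_coefC alg_polyC.
have [zs ezs] := closed_field_poly_normal (map_poly toC Q).
have lQ0 : lead_coef (map_poly toC Q) != 0.
  by rewrite lead_coef_map fmorph_eq0 gt_eqF.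
have zreal z : z \in zs -> toC (complex.Re z) = z.
  move=> zzs; have rz : (map_poly toC Q).[z] = 0.
    by apply/rootP; rewrite ezs rootZ // root_prod_XsubC.
  have [zJ|zJ] := eqVneq (z^*%C) z.
    case: z zJ {zzs rz} => x y /= [] y0; apply/eqP; rewrite eq_complex /= eqxx /=.
    by apply/eqP; lra.
  have [S S0] := num_den_conj c s0 sn zJ; rewrite -/Q rz rmorph0 !mul0r subrr.
  move=> /esym/eqP; rewrite mulf_eq0 subr_eq0 (negPf zJ) /=.
  by rewrite gt_eqF.
pose qs := map (@complex.Re R) zs.
have eQ : Q = lead_coef Q *: \prod_(q <- qs) ('X - q%:P).
  apply: (@map_poly_inj _ _ toC); rewrite [LHS]ezs linearZ /= lead_coef_map.
  congr (_ *: _); rewrite map_prod_XsubC big_map; apply: eq_big_seq => z zzs.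
  by rewrite -[in LHS](zreal z zzs).
have rQ q : q \in qs -> root Q q.
  by move=> qq; rewrite eQ rootZ ?gt_eqF // root_prod_XsubC.
(* At a zero of [Q] the wronskian reduces to -Q' times the denominator. *)
have w0 q : q \in qs -> Q^`().[q] * (den s).[q] < 0.
  move=> /rQ /rootP Qq; have := wronskian_gt0 c q Us s0 sn.
  by rewrite /wronskian !hornerE -/Q Qq; lra.
exists qs; split=> //.
  apply: uniq_deriv_prod => q /w0; apply: contraTneq => pq0.
  by rewrite eQ derivZ hornerZ pq0 mulr0 mul0r ltxx.
apply/allP => q qq; rewrite ltNge; apply/negP => q0.
have dq : (den s).[q] != 0.
  by apply: contraTneq (w0 q qq) => ->; rewrite mulr0 ltxx.
suff : 0 < Q.[q] by rewrite (rootP (rQ q qq)) ltxx.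
apply: num_gt0 => //; apply/allP => t ts; rewrite lt_neqAle.
rewrite (le_trans (allP sle _ ts) q0) andbT; apply: contraNneq dq => <-.
by rewrite -/(root _ _) root_den map_f.
Qed.

End Stieltjes.

(** * Duality and series connection on pairs of polynomials *)

Section Duality.
Local Open Scope ring_scope.
Variable R : comNzRingType.
Implicit Types e a b : {poly R} * {poly R}.

(* [e = (P, Q)] stands for the compliance [J = Q / P]; the dual pair stands for
   [1 / (x J)]. The flag [z] tells whether [P] vanishes at [0]. *)
Definition dual (z : bool) e : {poly R} * {poly R} :=
  if z then (e.2, drop_poly 1 e.1) else ('X * e.2, e.1).

(** The sum of two compliances. A common factor [x] is removed exactly when both flags are set: the
    boolean argument of [drop_poly] is read as the exponent 0 or 1. *)
Definition series (zA zB : bool) a b : {poly R} * {poly R} :=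
  (drop_poly (zA && zB) (a.1 * b.1),
   drop_poly (zA && zB) (a.1 * b.2 + a.2 * b.1)).

Lemma drop_poly1X (p : {poly R}) : drop_poly 1 ('X * p) = p.
Proof. by rewrite mulrC -['X]expr1 drop_polyMXn_id. Qed.

Lemma mulX_drop (p : {poly R}) : p`_0 = 0 -> 'X * drop_poly 1 p = p.
Proof.
move=> p0; apply/polyP => -[|i]; rewrite coefXM //= coef_drop_poly.
by rewrite addn1.
Qed.

Lemma dualK (z : bool) e : (z -> e.1`_0 = 0) -> dual (~~ z) (dual z e) = e.
Proof.
case: e => P Q; case: z => /= [/(_ isT) P0|_].
  by rewrite /dual /= mulX_drop.
by rewrite /dual /= drop_poly1X.
Qed.

Lemma seriesC zA zB a b : series zA zB a b = series zB zA b a.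
Proof.
rewrite /series andbC; congr (drop_poly _ _, drop_poly _ _); first exact: mulrC.
by rewrite addrC; congr (_ + _); exact: mulrC.
Qed.

End Duality.

Section Proportional.
Local Open Scope ring_scope.
Variable F : fieldType.
Implicit Types e a b : {poly F} * {poly F}.

(** Equality of constitutive equations before normalization. *)
Definition proportional e e' : Prop :=
  exists2 k : F, k != 0 & e = (k%:P * e'.1, k%:P * e'.2).

Lemma proportional_refl e : proportional e e.
Proof. by exists 1; rewrite ?oner_neq0 // !mul1r -surjective_pairing. Qed.

Lemma proportional_sym e e' : proportional e e' -> proportional e' e.
Proof.
case=> k k0 ->; exists k^-1; rewrite ?invr_eq0 //= !mulrA -polyCM mulVf //.
by rewrite !mul1r -surjective_pairing.
Qed.

Lemma proportional_trans e2 e1 e3 :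
  proportional e1 e2 -> proportional e2 e3 -> proportional e1 e3.
Proof.
case=> k k0 -> [l l0 ->]; exists (k * l); rewrite ?mulf_neq0 //=.
by rewrite polyCM !mulrA.
Qed.

Lemma drop_polyCM m (k : F) p : drop_poly m (k%:P * p) = k%:P * drop_poly m p.
Proof. by rewrite !mul_polyC drop_polyZ. Qed.

Lemma proportional_series zA zB a a' b b' :
  proportional a a' -> proportional b b' ->
  proportional (series zA zB a b) (series zA zB a' b').
Proof.
case=> k k0 -> [l l0 ->]; exists (k * l); first by rewrite mulf_neq0.
rewrite /series /= -!drop_polyCM polyCM; congr (drop_poly _ _, drop_poly _ _); ring.
Qed.

Lemma proportional_dual z e e' :
  proportional e e' -> proportional (dual z e) (dual z e').
Proof.
case=> k k0 ->; exists k => //; case: z; rewrite /dual /= ?drop_polyCM //.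
by rewrite mulrCA.
Qed.

Lemma proportional_den_num k k' c c' s s' : k != 0 -> k' != 0 ->
  proportional (k%:P * den s, k%:P * num c s) (k'%:P * den s', k'%:P * num c' s') ->
  den s = den s' /\ num c s = num c' s'.
Proof.
move=> k0 k'0 [l l0 [e1 e2]].
have kl : k = l * k'.
  have /(congr1 lead_coef) := e1; rewrite mulrA -polyCM !mul_polyC !lead_coefZ.
  by rewrite !(monicP (monic_den _)) !mulr1.
move: e1 e2; rewrite !mulrA -!polyCM -kl.
have kP : k%:P != 0 by rewrite polyC_eq0.
by move=> /(mulfI kP) -> /(mulfI kP) ->.
Qed.

End Proportional.

(** * Spectral types of Stieltjes pairs and their behaviour under duality *)

Section StieltjesPairs.
Local Open Scope ring_scope.
Variable R : rcfType.
Implicit Types (c : R) (s : seq (R * R)) (n : nat) (a z : bool).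
Implicit Types e : {poly R} * {poly R}.

Definition spectral n a z c s : bool :=
  [&& 0 <= c, (c != 0) == a, uniq (unzip1 s), pos_residues s, nonpos_poles s,
      (0 \in unzip1 s) == z & size s == (n + z)%N].

(* The pairs representing [c + \sum_(t <- s) t.2 / ('X - t.1)] with [n] nonzero
   poles; [a] tells whether [c > 0] and [z] whether [0] is a pole. *)
Definition stieltjes n a z e : Prop :=
  exists k c s, [/\ k != 0, spectral n a z c s &
                    e = (k%:P * den s, k%:P * num c s)].

Lemma stieltjes_coef0 n a z e : stieltjes n a z e -> z -> e.1`_0 = 0.
Proof.
case=> k [c [s [k0 /and5P[_ _ _ _ /and3P[_ /eqP <- _]] ->]]] /=.
by rewrite -root_den => /rootP; rewrite -horner_coef0 hornerM => ->; rewrite mulr0.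
Qed.

Lemma spectral_perm n a z c s s' :
  perm_eq s s' -> spectral n a z c s = spectral n a z c s'.
Proof.
move=> ss'; have uu : perm_eq (unzip1 s) (unzip1 s') by exact: perm_map.
rewrite /spectral (perm_uniq uu) (perm_mem uu) (perm_size ss').
by rewrite /pos_residues /nonpos_poles !(perm_all _ ss').
Qed.

(** The poles of 1 / (x J) are the zeros of J, which are simple and negative, together with 0 if J
    has no pole there. The degree of the numerator of J gives their number. The dimension hypothesis
    excludes J = 0. *)
Lemma stieltjes_dual n a z e : (0 < n + a + z)%N -> stieltjes n a z e ->
  stieltjes (n + a + z).-1 (~~ a) (~~ z) (dual z e).
Proof.
move=> dim [k [c [s [k0 sp ->]]]].
have /and5P[c0 /eqP ca Us s0 /and3P[sle /eqP zs /eqP szs]] := sp.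
have nz : (s != [::]) || (c != 0).
  rewrite ca -size_eq0 szs; case: (a) (z) dim => -[];
    by rewrite ?orbT ?addn0 ?orbF ?lt0n ?addn1.
have [qs [eQ Uq qlt]] := num_split c0 Us s0 nz sle.
have [szQ /(_ nz) l0] := size_num_eq c0 s0.
set l := lead_coef _ in eQ l0; set Q := num c s in eQ szQ *.
have szq : (size qs).+1 = (n + z + a)%N.
  rewrite -szs -ca -szQ eQ size_scale ?gt_eqF // size_prod_XsubC.
  by [].
(* [T] lists the poles of the dual; up to the factor [k], the dual pair is [(l%:P * M, W)], where
   [W] is [den s] with its factor [x] cancelled if 0 is a pole. *)
pose T := if z then qs else 0 :: qs.
pose M : {poly R} := \prod_(y <- T) ('X - y%:P).
have lM : l%:P * M = if z then Q else 'X * Q.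
  rewrite /M /T eQ; case: (z); rewrite ?big_cons ?subr0 mul_polyC //.
  by rewrite scalerAr.
pose W := if z then drop_poly 1 (den s) else den s.
have XW : (if z then 'X else 1) * W = den s.
  rewrite /W; case: (z) zs => zs; last by rewrite mul1r.
  by rewrite mulX_drop // -horner_coef0; apply/rootP; rewrite root_den.
have szW : size W = n.+1.
  rewrite /W; case: (z) szs => szs; rewrite ?size_drop_poly size_den szs.
    by rewrite addn1 subn1.
  by rewrite addn0.
have szT : size T = (n + a)%N.
  by rewrite /T; clear -szq; case: z szq => /=; lia.
have UT : uniq T.
  rewrite /T; case: (z) => //=; rewrite Uq andbT.
  by apply/negP => /(allP qlt); rewrite ltxx.
have [s' us' eW] : exists2 s', unzip1 s' = T &
    l^-1%:P * W = num (l^-1%:P * W)`_(size T) s'.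
  apply: partial_fractions => //; rewrite mul_polyC.
  by rewrite (leq_trans (size_scale_leq _ _)) // szW szT ltnS leq_addr.
set c' := _`__ in eW.
have ec' : c' = if a then 0 else l^-1.
  rewrite /c' coefCM szT; case: (a); rewrite ?addn1 ?addn0.
    by rewrite [W`__]nth_default ?mulr0 // szW.
  suff -> : W`_n = 1 by rewrite mulr1.
  have -> : n = (size W).-1 by rewrite szW.
  rewrite -lead_coefE; have := congr1 lead_coef XW.
  rewrite lead_coefM (monicP (monic_den s)).
  by case: (z); rewrite ?lead_coefX ?lead_coef1 mul1r.
have dM : den s' = M by rewrite denE us'.
(* The residue at [x] is W(x) / (l M'(x)) with l > 0, so this is its sign. At a zero of [Q] it
   follows from the wronskian, at 0 from Q(0) > 0 and den(0) > 0. *)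
have WM x : x \in T -> 0 < W.[x] * M^`().[x].
  move=> xT.
  have qP : x \in qs -> [/\ x < 0, Q.[x] = 0 & Q^`().[x] * (den s).[x] < 0].
    move=> xq; split; first exact: (allP qlt).
      by apply/rootP; rewrite eQ rootZ ?gt_eqF // root_prod_XsubC.
    have sn : s != [::].
      apply: contraTneq xq => s00; move: szq.
      rewrite -szs s00 add0n; case: (a) => //= -[/eqP]; rewrite size_eq0.
      by move=> /eqP ->.
    have := wronskian_gt0 c x Us s0 sn.
    rewrite /wronskian !hornerE -/Q.
    suff -> : Q.[x] = 0 by lra.
    by apply/rootP; rewrite eQ rootZ ?gt_eqF // root_prod_XsubC.
  rewrite -(pmulr_lgt0 _ l0).
  have := congr1 (fun p => (p^`()).[x]) lM.
  rewrite /= derivM derivC mul0r add0r hornerM hornerC => elM.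
  have := congr1 (fun p => p.[x]) XW; rewrite /= hornerM => eXW.
  move: xT elM eXW; rewrite /T; case: (z) zs => zs.
    move=> /qP[x0 _ w0]; rewrite hornerX => elM eXW.
    rewrite -(nmulr_rlt0 _ x0).
    suff -> : x * (W.[x] * M^`().[x] * l) = Q^`().[x] * (den s).[x] by [].
    by rewrite -eXW -elM; ring.
  rewrite inE hornerC mul1r derivM derivX mul1r hornerD hornerM hornerX.
  case/predU1P => [->|/qP[x0 -> w0]]; last first.
    move=> elM ->; rewrite -(pmulr_rgt0 _ l0).
    rewrite pmulr_rgt0 // -mulrA [_ * l]mulrC elM add0r.
    rewrite mulrCA nmulr_rgt0 // mulrC //.
  rewrite mul0r addr0 => elM ->; rewrite -mulrA [_ * l]mulrC elM.
  have neg : all (fun t : R * R => t.1 < 0) s.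
    apply/allP => t ts; rewrite lt_neqAle (allP sle _ ts) andbT.
    by apply/eqP => t0; move: zs; rewrite -t0 map_f.
  apply: mulr_gt0; last exact: num_gt0.
  rewrite /den; elim: (s) neg => [|t s1 IH] /=; first by rewrite big_nil hornerC.
  by case/andP => t0 /IH; rewrite big_cons !hornerE => h; rewrite mulr_gt0 // oppr_gt0.
exists (k * l), c', s'; split; first by rewrite mulf_neq0 // gt_eqF.
  have l1 : 0 < l^-1 by rewrite invr_gt0.
  apply/and5P; split.
  - by rewrite ec'; case: (a) => //; exact: ltW.
  - by rewrite ec'; case: (a); rewrite /= ?eqxx // (gt_eqF l1).
  - by rewrite us'.
  - apply/allP => t ts.
    have tT : t.1 \in T by rewrite -us' map_f.
    have Us' : uniq (unzip1 s') by rewrite us'.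
    have := num_residue c' Us' ts; rewrite -eW hornerM hornerC dM => eR.
    have := mulr_gt0 l1 (WM _ tT); rewrite mulrA eR -mulrA pmulr_lgt0 //.
    rewrite -expr2 lt0r sqr_ge0 andbT sqrf_eq0.
    by apply: contraTneq (WM _ tT) => ->; rewrite mulr0 ltxx.
  - have Tle : all (fun y => y <= 0) T.
      have qle : all (fun y => y <= 0) qs.
        by apply/allP => q /(allP qlt) /ltW.
      by rewrite /T; case: (z); rewrite //= lexx.
    apply/and3P; split.
    + by apply/allP => t ts; apply: (allP Tle); rewrite -us' map_f.
    + rewrite us' /T; case: (z); rewrite ?inE ?eqxx //= eqbF_neg.
      by apply/negP => /(allP qlt); rewrite ltxx.
    + move: szT; rewrite -us' size_map => ->.
      by clear -dim; case: z dim => /=; lia.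
rewrite -eW dM polyCM -!mulrA lM /dual /= [l%:P * _]mulrA -polyCM mulfV ?gt_eqF //.
rewrite mul1r /W; case: (z) => //=; first by rewrite drop_polyCM.
by rewrite mulrCA.
Qed.

End StieltjesPairs.

(** * Families of compliances *)

Section SpectralData.
Local Open Scope ring_scope.
Variable R : rcfType.
Implicit Types (c : R) (s : seq (R * R)) (n : nat) (a z : bool).

Lemma spectral_residue n a z c s y r r' :
  spectral n a z c ((y, r) :: s) -> 0 < r' -> spectral n a z c ((y, r') :: s).
Proof.
by rewrite /spectral /= => /and5P[-> -> -> /andP[_ ->] ->] ->.
Qed.

Lemma spectral_swap n a z c s y r u q :
  spectral n a z c ((y, r) :: s) -> y != 0 -> u != 0 -> u \notin unzip1 s ->
  u <= 0 -> 0 < q -> spectral n a z c ((u, q) :: s).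
Proof.
move=> sp y0 u0 us u_le q0; move: sp.
rewrite /spectral /= us u_le q0 !inE ![0 == _]eq_sym (negPf y0) (negPf u0) /=.
by case/and5P=> -> -> /andP[_ ->] /andP[_ ->] /and3P[/andP[_ ->] -> ->].
Qed.

Lemma spectral_nonzero_pole n a z c s : spectral n a z c s -> (0 < n)%N ->
  exists2 t, t \in s & t.1 != 0.
Proof.
case/and5P=> _ _ Us _ /and3P[_ /eqP zs /eqP szs] n0.
have [/hasP[t ts t0]|/hasPn all0] := boolP (has (fun t : R * R => t.1 != 0) s).
  by exists t.
have sub : {subset unzip1 s <= [:: 0 : R]}.
  by move=> _ /mapP[t /all0 + ->]; rewrite negbK inE.
have := uniq_leq_size Us sub; rewrite size_map szs /=.
case: (z) zs => zs; first by rewrite addn1 ltnS leqNgt n0.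
case: s szs zs all0 {Us sub} => [|t s] /=; first by move: n0; case: n.
move=> _ zs /(_ t (mem_head _ _)); rewrite negbK => /eqP t0.
by rewrite inE t0 eqxx in zs.
Qed.

Lemma spectral0 n a z c s : spectral n a z c s -> n = 0%N ->
  exists2 r, 0 < r & s = if z then [:: (0, r)] else [::].
Proof.
move=> + n0; rewrite {}n0 => /and5P[_ _ _ s0 /and3P[_ /eqP zs /eqP]].
case: (z) zs => zs szs; last by exists 1 => //; case: s szs {s0 zs}.
case: s szs s0 zs => [|[y r] [|]] //= _ /andP[r0 _]; rewrite inE => /eqP y0.
by exists r => //; rewrite -y0.
Qed.

End SpectralData.

Section Systems.
Local Open Scope ring_scope.
Variables (R : rcfType) (T : eqType).
Implicit Types (v w : T -> R) (V : seq T) (f g : (T -> R) -> {poly R} * {poly R}).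
Implicit Types (n : nat) (a z : bool) (e : {poly R} * {poly R}).

Definition positive v := forall p, 0 < v p.

Definition depends_on V f := forall v w, {in V, v =1 w} -> f v = f w.

Definition off V v w := forall p, p \notin V -> w p = v p.

(* Every compliance of a given spectral type is realized by exactly one choice
   of the parameters in [V]. *)
Record universal V f n a z : Prop := {
  universal_dim : (0 < n + a + z)%N;
  universal_sound : forall v, positive v -> stieltjes n a z (f v);
  universal_complete : forall e, stieltjes n a z e ->
    exists2 v, positive v & proportional (f v) e;
  universal_inj : forall v w, positive v -> positive w ->
    proportional (f v) (f w) -> {in V, v =1 w} }.

(** Parameters outside [V] are frozen, so that a twin for a subnetwork remains one for the whole
    network. The case [w = v] is allowed; distinctness is imposed in the two notions below. *)
Definition twin V f v w := [/\ positive w, off V v w & proportional (f w) (f v)].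

Definition ambiguous V f := forall v, positive v ->
  exists2 w, twin V f v w & w <> v.

Definition infinitely_ambiguous V f := forall v, positive v ->
  exists2 w : nat -> T -> R, injective w & forall k, twin V f v (w k).

Lemma infinitely_ambiguousW V f : infinitely_ambiguous V f -> ambiguous V f.
Proof.
move=> inf v /inf[w iw tw]; have [w0|w0] := pselect (w 0%N = v).
  by exists (w 1%N) => // w1; have /iw := etrans w0 (esym w1).
by exists (w 0%N).
Qed.

Section Transfer.
Variables (V W : seq T) (f g : (T -> R) -> {poly R} * {poly R}).
Hypothesis VW : {subset V <= W}.
Hypothesis fg : forall v w, proportional (f w) (f v) -> off V v w ->
  proportional (g w) (g v).

Lemma twin_transfer v w : twin V f v w -> twin W g v w.
Proof.
case=> w0 o p; split=> //; last exact: fg.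
by move=> q qW; apply: o; apply: contra qW; exact: VW.
Qed.

Lemma ambiguous_transfer : ambiguous V f -> ambiguous W g.
Proof. by move=> amb v /amb[w /twin_transfer tw wv]; exists w. Qed.

Lemma infinitely_ambiguous_transfer :
  infinitely_ambiguous V f -> infinitely_ambiguous W g.
Proof.
by move=> amb v /amb[w iw tw]; exists w => // k; exact: twin_transfer.
Qed.

End Transfer.

Lemma universal_ext V W f g n a z : V =i W -> f =1 g ->
  universal V f n a z -> universal W g n a z.
Proof.
move=> VW fg [dim snd cpl inj]; split=> //.
- by move=> v /snd; rewrite fg.
- by move=> e /cpl[v v0]; rewrite fg; exists v.
- by move=> v w v0 w0; rewrite -!fg => /(inj _ _ v0 w0) vw p; rewrite -VW; exact: vw.
Qed.

(** Duality is an involution, up to the flag, between the Stieltjes pairs of the two types, and it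
    respects proportionality. *)
Lemma universal_dual V f n a z : universal V f n a z ->
  universal V (dual z \o f) (n + a + z).-1 (~~ a) (~~ z).
Proof.
case=> dim snd cpl inj.
have K e : stieltjes n a z e -> dual (~~ z) (dual z e) = e.
  by move=> /stieltjes_coef0 e0; exact: dualK.
split.
- by clear -dim; case: a dim; case: z => /=; lia.
- by move=> v /snd; exact: stieltjes_dual.
- move=> e se.
  have se' : stieltjes n a z (dual (~~ z) e).
    have := stieltjes_dual _ se.
    rewrite !negbK.
    have -> : ((n + a + z).-1 + ~~ a + ~~ z).-1 = n.
      by clear -dim; case: a dim; case: z => /=; lia.
    by apply; clear -dim; case: a dim; case: z => /=; lia.
  have [v v0 /(proportional_dual z) pv] := cpl _ se'.
  exists v => //; apply: proportional_trans pv _.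
  rewrite -{1}(negbK z) dualK; first exact: proportional_refl.
  exact: stieltjes_coef0 se.
- move=> v w v0 w0 /= /(proportional_dual (~~ z)).
  by rewrite !K; [exact: inj | exact: snd..].
Qed.

(** * Series connection of two universal families with disjoint parameters *)

Section Series.
Variables (VA VB : seq T) (f g : (T -> R) -> {poly R} * {poly R}).
Hypothesis disj : ~~ has (mem VA) VB.
Hypothesis depA : depends_on VA f.
Hypothesis depB : depends_on VB g.
Variables (zA zB : bool).

Let h v := series zA zB (f v) (g v).

Let notin_VA p : p \in VB -> p \notin VA.
Proof. by move=> pB; apply: contra disj => pA; apply/hasP; exists p. Qed.

Variables (nA nB : nat) (aA aB : bool).
Hypothesis UA : universal VA f nA aA zA.
Hypothesis UB : universal VB g nB aB zB.

Lemma realize_series v eA eB : positive v ->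
  stieltjes nA aA zA eA -> stieltjes nB aB zB eB ->
  exists w, [/\ positive w, off (VA ++ VB) v w, proportional (f w) eA &
                proportional (g w) eB].
Proof.
move=> v0 /(universal_complete UA)[vA vA0 pA] /(universal_complete UB)[vB vB0 pB].
exists (fun p => if p \in VA then vA p else if p \in VB then vB p else v p).
split.
- by move=> p; case: ifP => // _; case: ifP.
- by move=> p; rewrite mem_cat negb_or => /andP[/negPf-> /negPf->].
- by rewrite (depA (w := vA)) // => p ->.
- by rewrite (depB (w := vB)) // => p pb; rewrite (negPf (notin_VA pb)) pb.
Qed.

Lemma twin_series v eA eB : positive v ->
  stieltjes nA aA zA eA -> stieltjes nB aB zB eB ->
  series zA zB eA eB = h v ->
  exists2 w, twin (VA ++ VB) h v w & proportional (f w) eA.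
Proof.
move=> v0 sA sB e; have [w [w0 o pA pB]] := realize_series v0 sA sB.
by exists w => //; split=> //; rewrite -e; exact: proportional_series.
Qed.

(* [q] is a quantity (a constant or a residue) of the second network of which an
   arbitrary part [x] is moved to the first one. *)
Lemma trade v (eA eB : R -> {poly R} * {poly R}) (q : R) : positive v -> 0 < q ->
  (forall x, 0 <= x -> stieltjes nA aA zA (eA x)) ->
  (forall x, 0 <= x < q -> stieltjes nB aB zB (eB x)) ->
  (forall x, series zA zB (eA x) (eB x) = h v) ->
  (forall x y, proportional (eA x) (eA y) -> x = y) ->
  exists2 w : nat -> T -> R, injective w & forall k, twin (VA ++ VB) h v (w k).
Proof.
(* The amounts q / (k + 2) are pairwise distinct and lie strictly between 0 and q. *)
move=> v0 q0 sA sB e inj; pose x k := q / k.+2%:R.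
have x0 k : 0 <= x k by rewrite divr_ge0 ?ltW.
have xq k : 0 <= x k < q.
  by rewrite x0 /= ltr_pdivrMr ?ltr0n // ltr_pMr // ltr1n.
have [w tw] : {w : nat -> T -> R & forall k,
    twin (VA ++ VB) h v (w k) /\ proportional (f (w k)) (eA (x k))}.
  apply: (@choice nat (T -> R) (fun k u => twin (VA ++ VB) h v u /\
    proportional (f u) (eA (x k)))) => k.
  by have [u tu pu] := twin_series v0 (sA _ (x0 k)) (sB _ (xq k)) (e _); exists u.
exists w => [k l wkl|k]; last exact: (tw k).1.
have : x k = x l.
  apply: inj; apply: proportional_trans (tw l).2.
  by rewrite -wkl; apply: proportional_sym; exact: (tw k).2.
move/(mulfI (lt0r_neq0 q0))/invr_inj/eqP; rewrite eqr_nat => /eqP[].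
by [].
Qed.

Lemma trade_constant : aA -> aB -> infinitely_ambiguous (VA ++ VB) h.
Proof.
move=> aAT aBT v v0.
have [kA [cA [sA [kA0 spA eA]]]] := universal_sound UA v0.
have [kB [cB [sB [kB0 spB eB]]]] := universal_sound UB v0.
have /and5P[cA0 /eqP caA _ _ _] := spA; have /and5P[cB0 /eqP caB _ _ _] := spB.
have cBp : 0 < cB by rewrite lt0r cB0 caB aBT.
apply: (trade (eA := fun x => (kA%:P * den sA, kA%:P * num (cA + x) sA))
              (eB := fun x => (kB%:P * den sB, kB%:P * num (cB - x) sB))
              v0 cBp).
- move=> x x0; exists kA, (cA + x), sA; split=> //.
  move: spA; rewrite /spectral addr_ge0 // cA0 /= => /andP[_ ->].
  rewrite andbT aAT eqb_id gt_eqF // ltr_wpDr // lt0r cA0 caA.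
  by rewrite aAT.
- move=> x /andP[x0 xB]; exists kB, (cB - x), sB; split=> //.
  move: spB; rewrite /spectral subr_ge0 cB0 (ltW xB) /= => /andP[_ ->].
  by rewrite andbT aBT eqb_id subr_eq0 gt_eqF.
- move=> x; rewrite /h eA eB /series /= !num_shift polyCN.
  by congr (drop_poly _ _, drop_poly _ _); ring.
- move=> x y /proportional_den_num[] // _.
  by move/(congr1 (fun p : {poly R} => p`_(size sA))); rewrite /= !coef_num => /addrI.
Qed.

(** Part of the residue at the common pole [y] is moved. The statement is pointwise in [v], because
    two networks may share a nonzero pole for particular parameters only. *)
Lemma trade_pole v kA kB cA cB sA sB y : positive v ->
  kA != 0 -> spectral nA aA zA cA sA -> f v = (kA%:P * den sA, kA%:P * num cA sA) ->
  kB != 0 -> spectral nB aB zB cB sB -> g v = (kB%:P * den sB, kB%:P * num cB sB) ->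
  y \in unzip1 sA -> y \in unzip1 sB ->
  exists2 w : nat -> T -> R, injective w & forall k, twin (VA ++ VB) h v (w k).
Proof.
move=> v0 kA0 spA eA kB0 spB eB /mapP[[y1 r] tA /= ->] /mapP[[y2 q] tB /= yy].
rewrite -{}yy in tB.
have pA := perm_to_rem tA; have pB := perm_to_rem tB.
rewrite (spectral_perm _ _ _ _ pA) in spA; rewrite (spectral_perm _ _ _ _ pB) in spB.
have /and5P[_ _ _ /andP[r0 _] _] := spA; have /and5P[_ _ _ /andP[q0 _] _] := spB.
rewrite /= in r0 q0.
set sA' := rem _ sA in pA spA; set sB' := rem _ sB in pB spB.
apply: (trade
  (eA := fun x => (kA%:P * den ((y1, r + x) :: sA'),
                   kA%:P * num cA ((y1, r + x) :: sA')))
  (eB := fun x => (kB%:P * den ((y1, q - x) :: sB'),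
                   kB%:P * num cB ((y1, q - x) :: sB')))
  v0 q0).
- move=> x x0; exists kA, cA, ((y1, r + x) :: sA'); split=> //.
  by apply: spectral_residue spA _; rewrite ltr_wpDr.
- move=> x /andP[_ xq]; exists kB, cB, ((y1, q - x) :: sB'); split=> //.
  by apply: spectral_residue spB _; rewrite subr_gt0.
- move=> x; rewrite /h eA eB (den_perm pA) (den_perm pB) (num_perm _ pA) (num_perm _ pB).
  rewrite /series /= !den_cons /= !polyCD polyCN.
  by congr (drop_poly _ _, drop_poly _ _); ring.
- move=> x y' /proportional_den_num[] // _ /= /addrI.
  by move/(mulIf (monic_neq0 (monic_den _)))/polyC_inj/addrI.
Qed.

Lemma trade_pole_zero : zA -> zB -> infinitely_ambiguous (VA ++ VB) h.
Proof.
move=> zAT zBT v v0.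
have [kA [cA [sA [kA0 spA eA]]]] := universal_sound UA v0.
have [kB [cB [sB [kB0 spB eB]]]] := universal_sound UB v0.
have /and5P[_ _ _ _ /and3P[_ /eqP z1 _]] := spA.
have /and5P[_ _ _ _ /and3P[_ /eqP z2 _]] := spB.
by apply: (trade_pole (y := 0) v0 kA0 spA eA kB0 spB eB); rewrite ?z1 ?z2.
Qed.

(* If the pole sets are disjoint, a pole of one network is exchanged, together
   with its residue, for a pole of the other; at a common pole some residue is
   traded. *)
Lemma swap_poles : (0 < nA)%N -> (0 < nB)%N -> ambiguous (VA ++ VB) h.
Proof.
move=> nA0 nB0 v v0.
have [kA [cA [sA [kA0 spA eA]]]] := universal_sound UA v0.
have [kB [cB [sB [kB0 spB eB]]]] := universal_sound UB v0.
have [|disj_poles] := boolP (has (mem (unzip1 sA)) (unzip1 sB)).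
  case/hasP=> y yB yA.
  have [w iw tw] := trade_pole v0 kA0 spA eA kB0 spB eB yA yB.
  have [w0|w0] := pselect (w 0%N = v).
    by exists (w 1%N) => // w1; have /iw := etrans w0 (esym w1).
  by exists (w 0%N).
have [[y r] tA y0] := spectral_nonzero_pole spA nA0.
have [[u q] tB u0] := spectral_nonzero_pole spB nB0.
have notA x : x \in unzip1 sB -> x \notin unzip1 sA.
  by move=> xB; apply: contra disj_poles => xA; apply/hasP; exists x.
have uA : u \notin unzip1 sA by apply: notA; exact: (map_f fst tB).
have yB : y \notin unzip1 sB by apply: contraL (map_f fst tA); exact: notA.
have pA := perm_to_rem tA; have pB := perm_to_rem tB.
rewrite (spectral_perm _ _ _ _ pA) in spA; rewrite (spectral_perm _ _ _ _ pB) in spB.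
rewrite (perm_mem (perm_map fst pA)) /= inE negb_or in uA.
rewrite (perm_mem (perm_map fst pB)) /= inE negb_or in yB.
set sA' := rem _ sA in pA spA uA; set sB' := rem _ sB in pB spB yB.
have /andP[uy uA'] := uA; have /andP[_ yB'] := yB.
have /and5P[_ _ _ /andP[r0 _] /andP[/andP[yle _] _]] := spA.
have /and5P[_ _ _ /andP[q0 _] /andP[/andP[ule _] _]] := spB.
rewrite /= in y0 u0 r0 q0 yle ule.
(* The combined list of poles and residues is unchanged by the exchange, hence so is the sum of the
   compliances. *)
have [w tw pw] : exists2 w, twin (VA ++ VB) h v w &
    proportional (f w) (kA%:P * den ((u, q) :: sA'), kA%:P * num cA ((u, q) :: sA')).
  apply: (twin_series
    (eB := (kB%:P * den ((y, r) :: sB'), kB%:P * num cB ((y, r) :: sB'))) v0).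
  - exists kA, cA, ((u, q) :: sA'); split=> //.
    exact: spectral_swap spA _ _ _ _ _.
  - exists kB, cB, ((y, r) :: sB'); split=> //.
    exact: spectral_swap spB _ _ _ _ _.
  rewrite /h eA eB (den_perm pA) (den_perm pB) (num_perm _ pA) (num_perm _ pB).
  rewrite /series /= !den_cons /=.
  by congr (drop_poly _ _, drop_poly _ _); ring.
(* If [w] were [v], then [u] would already be a pole of the first network. *)
exists w => // wv; move: pw; rewrite {}wv eA => /proportional_den_num[] // dd _.
have : root (den sA) u by rewrite dd root_den mem_head.
rewrite (den_perm pA) root_den /= inE (negPf uy) /=.
by rewrite (negPf uA').
Qed.

(** The second compliance is [c], [r / x] or [c + r / x], and the first has no part of the same
    kind. The constant and the pole at 0 of the sum thus have a unique owner, and all nonzero poles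
    belong to the first network. *)
Lemma universal_series : nB = 0%N -> ~~ (aA && aB) -> ~~ (zA && zB) ->
  universal (VA ++ VB) h nA (aA || aB) (zA || zB).
Proof.
move=> nB0 aAB zAB; have zF : zA && zB = false by exact: negbTE.
have ser eA eB : series zA zB eA eB = (eA.1 * eB.1, eA.1 * eB.2 + eA.2 * eB.1).
  by rewrite /series zF !drop_poly0l.
split.
- by have := universal_dim UA; case: (aA); case: (zA) => /=; lia.
- move=> v v0.
  have [kA [cA [sA [kA0 spA eA]]]] := universal_sound UA v0.
  have [kB [cB [sB [kB0 spB eB]]]] := universal_sound UB v0.
  exists (kA * kB), (cA + cB), (sB ++ sA); split; first by rewrite mulf_neq0.
    have [r r0 esB] := spectral0 spB nB0.
    move: spA spB => /and5P[cA0 /eqP caA UsA rA /and3P[pA /eqP zeA /eqP szA]].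
    move=> /and5P[cB0 /eqP caB _ _ _].
    rewrite /spectral addr_ge0 //= paddr_eq0 // negb_and caA caB eqxx /=.
    rewrite esB; case: (zB) zF => /=; last first.
      by move=> _; rewrite UsA rA pA zeA szA orbF !eqxx.
    rewrite andbT => zA0; rewrite UsA rA r0 lexx pA szA zeA zA0 in_cons eqxx /=.
    by rewrite addn0 addn1 eqxx.
  by rewrite /h ser eA eB /= num_add den_cat polyCM; congr (_, _); ring.
- move=> e [k [c [s [k0 sp ->]]]].
  (* At most one network has a constant term, and it receives all of [c]. *)
  pose cA := if aB then 0 else c; pose cB := if aB then c else 0.
  have cE : c = cA + cB by rewrite /cA /cB; case: (aB); rewrite ?add0r ?addr0.
  have [sA [sB [ss spA spB]]] : exists sA sB, [/\ perm_eq s (sB ++ sA),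
      spectral nA aA zA cA sA & spectral nB aB zB cB sB].
    rewrite nB0; case: (zB) zF sp => /= [|_]; last first.
      rewrite orbF => /and5P[c0 /eqP ca Us s0 /and3P[ps zs szs]].
      exists s, [::]; split=> //; rewrite /spectral ?Us ?s0 ?ps ?zs ?szs /=.
        rewrite /cA !andbT; case: (aB) aAB ca; rewrite ?andbT ?orbF ?lexx ?eqxx /=.
          by move=> /negPf->.
        by move=> _ ->; rewrite c0 eqxx.
      rewrite /cB !andbT; case: (aB) ca; rewrite ?orbT ?lexx ?eqxx //=.
      by move=> ->; rewrite c0.
    rewrite andbT orbT => zA0 sp.
    have /and5P[_ _ _ _ /and3P[_ /eqP/mapP[[y r] ts /= y0] _]] := sp.
    rewrite -{}y0 in ts; have pm := perm_to_rem ts.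
    rewrite (spectral_perm _ _ _ _ pm) in sp.
    exists (rem (0, r) s), [:: (0, r)]; split=> //.
      move: sp; rewrite /spectral /=.
      move=> /and5P[c0 /eqP ca /andP[us Us] /andP[_ s0] /and3P[/andP[_ ps] _ szs]].
      rewrite addn1 eqSS -[nA]addn0 in szs.
      rewrite /spectral Us s0 ps (negPf us) zA0 szs eqxx !andbT.
      rewrite /cA; case: (aB) aAB ca; rewrite ?andbT ?orbF ?lexx ?eqxx /=.
        by move=> /negPf->.
      by move=> _ ->; rewrite c0 eqxx.
    move: sp => /and5P[c0 /eqP ca _ /andP[r0 _] _].
    rewrite /spectral /= r0 lexx inE eqxx !andbT.
    rewrite /cB; case: (aB) ca; rewrite ?orbT ?lexx ?eqxx //=.
    by move=> ->; rewrite c0.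
  have sA' : stieltjes nA aA zA (den sA, num cA sA).
    by exists 1, cA, sA; split=> //; rewrite ?oner_neq0 ?polyC1 ?mul1r.
  have sB' : stieltjes nB aB zB (den sB, num cB sB).
    by exists 1, cB, sB; split=> //; rewrite ?oner_neq0 ?polyC1 ?mul1r.
  have [v [v0 _ pA pB]] := realize_series (fun _ => ltr01) sA' sB'.
  exists v => //; apply: proportional_trans (proportional_series zA zB pA pB) _.
  exists k^-1; rewrite ?invr_eq0 // ser /= !mulrA -polyCM mulVf // !mul1r.
  by rewrite (den_perm ss) (num_perm _ ss) cE num_add den_cat mulrC.
- move=> v w v0 w0.
  have [kA [cA [sA [kA0 spA eA]]]] := universal_sound UA v0.
  have [kB [cB [sB [kB0 spB eB]]]] := universal_sound UB v0.
  have [lA [dA [tA [lA0 spA' eA']]]] := universal_sound UA w0.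
  have [lB [dB [tB [lB0 spB' eB']]]] := universal_sound UB w0.
  have hE : h v = ((kA * kB)%:P * den (sB ++ sA),
                   (kA * kB)%:P * num (cA + cB) (sB ++ sA)).
    by rewrite /h ser eA eB /= num_add den_cat polyCM; congr (_, _); ring.
  have hE' : h w = ((lA * lB)%:P * den (tB ++ tA),
                    (lA * lB)%:P * num (dA + dB) (tB ++ tA)).
    by rewrite /h ser eA' eB' /= num_add den_cat polyCM; congr (_, _); ring.
  rewrite hE hE' => /proportional_den_num[||dE nE]; rewrite ?mulf_neq0 //.
  have [r r0 esB] := spectral0 spB nB0; have [q q0 etB] := spectral0 spB' nB0.
  (* The second denominator is 1 or [x] for both parameter choices, so it cancels from the equality
     of the products. *)
  have dBE : den sB = den tB by rewrite esB etB; case: (zB); rewrite // !den_cons.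
  have dAE : den sA = den tA.
    by apply: (mulfI (monic_neq0 (monic_den sB))); rewrite -den_cat dE den_cat dBE.
  have cE : cA + cB = dA + dB.
    rewrite -(coef_num (cA + cB) (sB ++ sA)) nE.
    have -> : size (sB ++ sA) = size (tB ++ tA).
      by apply: succn_inj; rewrite -!size_den dE.
    by rewrite coef_num.
  have [cAE cBE] : cA = dA /\ cB = dB.
    move: spA spA' spB spB' => /and5P[_ /eqP + _ _ _] /and5P[_ /eqP + _ _ _].
    move=> + + /and5P[_ /eqP + _ _ _] /and5P[_ /eqP + _ _ _].
    case: (aB) aAB => [|_].
      rewrite andbT => /negPf-> /negbFE/eqP cA0 /negbFE/eqP dA0 _ _.
      by move: cE; rewrite cA0 dA0 !add0r.
    move=> _ _ /negbFE/eqP cB0 /negbFE/eqP dB0.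
    by move: cE; rewrite cB0 dB0 !addr0.
  (* If the second network owns the pole at 0, its residue is read off by evaluating the total
     numerator at 0, where [den sA] does not vanish. *)
  have rE : num cB sB = num dB tB.
    rewrite cBE esB etB; case: (zB) zF esB etB => // + esB etB.
    rewrite andbT => zA0; congr num; congr [:: (_, _)].
    have := congr1 (fun p : {poly R} => p.[0]) nE.
    rewrite esB etB /= !hornerD !hornerM !hornerXsubC subrr !mul0r !add0r !hornerC dAE.
    apply: mulIf; rewrite -/(root _ _) root_den.
    by move: spA' => /and5P[_ _ _ _ /and3P[_ /eqP -> _]]; rewrite zA0.
  have nAE : num cA sA = num dA tA.
    move: nE; rewrite !num_add rE dBE dAE => /addrI.
    by apply: mulIf; exact: monic_neq0 (monic_den _).
  have fE : proportional (f v) (f w).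
    rewrite eA eA' dAE nAE; exists (kA / lA); first by rewrite mulf_neq0 ?invr_eq0.
    by rewrite /= !mulrA -polyCM divfK.
  have gE : proportional (g v) (g w).
    rewrite eB eB' dBE rE; exists (kB / lB); first by rewrite mulf_neq0 ?invr_eq0.
    by rewrite /= !mulrA -polyCM divfK.
  move=> p; rewrite mem_cat => /orP[pA|pB].
    exact: (universal_inj UA v0 w0 fE).
  exact: (universal_inj UB v0 w0 gE).
Qed.

End Series.

Lemma infinitely_ambiguous_ext V W f g : V =i W -> f =1 g ->
  infinitely_ambiguous V f -> infinitely_ambiguous W g.
Proof.
move=> VW fg; apply: infinitely_ambiguous_transfer; first by move=> p; rewrite VW.
by move=> v w; rewrite !fg.
Qed.

(** A shared constant or a shared pole at 0 can be traded; nonzero poles on both sides can be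
    swapped; in the remaining case the sum splits uniquely. *)
Lemma series_trichotomy (VA VB : seq T) f g nA nB aA aB zA zB :
  ~~ has (mem VA) VB -> depends_on VA f -> depends_on VB g ->
  universal VA f nA aA zA -> universal VB g nB aB zB ->
  let h := fun v => series zA zB (f v) (g v) in
  [\/ infinitely_ambiguous (VA ++ VB) h,
      [/\ (0 < nA)%N, (0 < nB)%N & ambiguous (VA ++ VB) h] |
      [/\ (nA == 0%N) || (nB == 0%N), ~~ (aA && aB), ~~ (zA && zB) &
          universal (VA ++ VB) h (nA + nB)%N (aA || aB) (zA || zB)]].
Proof.
move=> disj dA dB UA UB h.
have [/andP[aAT aBT]|aAB] := boolP (aA && aB).
  by constructor 1; have := trade_constant disj dA dB UA UB aAT aBT.
have [/andP[zAT zBT]|zAB] := boolP (zA && zB).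
  by constructor 1; have := trade_pole_zero disj dA dB UA UB zAT zBT.
have [nB0|nB0] := posnP nB.
  constructor 3; split; rewrite ?nB0 ?orbT ?addn0 //.
  by have := universal_series disj dA dB UA UB nB0 aAB zAB.
have [nA0|nA0] := posnP nA.
  constructor 3; split; rewrite ?nA0 ?add0n //.
  rewrite orbC [zA || zB]orbC.
  rewrite andbC in aAB; rewrite andbC in zAB; rewrite has_sym in disj.
  apply: universal_ext (universal_series disj dB dA UB UA nA0 aAB zAB).
    by move=> p; rewrite !mem_cat orbC.
  by move=> v; exact: seriesC.
by constructor 2; split=> //; have := swap_poles disj dA dB UA UB nA0 nB0.
Qed.

End Systems.

(** * Generic coprimality *)

Section Coprimality.
Local Open Scope ring_scope.

(** Nonvanishing of the images of the leading coefficients keeps the size of the Sylvester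
    matrix. *)
Lemma resultant_map (D : comNzRingType) (D' : nzRingType) (f : {rmorphism D -> D'})
    (p q : {poly D}) : f (lead_coef p) != 0 -> f (lead_coef q) != 0 ->
  f (resultant p q) = resultant (map_poly f p) (map_poly f q).
Proof.
move=> fp fq; rewrite /resultant /Sylvester_mx !size_map_poly_id0 //.
rewrite -det_map_mx map_col_mx; congr (\det (col_mx _ _));
  by apply: map_lin1_mx => u; rewrite /= map_poly_rV rmorphM /= map_rVpoly.
Qed.

(** Coprimality is nonvanishing of the resultant. If its image under the specialization [f] is
    nonzero, the resultant is nonzero in [D], hence also under the injective [g]. *)
Lemma coprimep_specialize (D : idomainType) (F F' : fieldType)
    (f : {rmorphism D -> F}) (g : {rmorphism D -> F'}) (p q : {poly D}) :
  injective g -> f (lead_coef p) != 0 -> f (lead_coef q) != 0 ->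
  coprimep (map_poly f p) (map_poly f q) -> coprimep (map_poly g p) (map_poly g q).
Proof.
move=> gI fp fq.
have g0 a : f a != 0 -> g a != 0.
  move=> fa; rewrite -(rmorph0 g) (inj_eq gI).
  by apply: contraNneq fa => ->; rewrite rmorph0.
have res (E : fieldType) (h : {rmorphism D -> E}) : h (lead_coef p) != 0 ->
    h (lead_coef q) != 0 ->
    coprimep (map_poly h p) (map_poly h q) = (h (resultant p q) != 0).
  move=> hp hq; rewrite resultant_map // resultant_eq0 -leqNgt /coprimep eqn_leq.
  suff -> : (0 < size (gcdp (map_poly h p) (map_poly h q)))%N by rewrite andbT.
  rewrite size_poly_gt0 gcdp_eq0 negb_and -lead_coef_eq0.
  by rewrite lead_coef_map_eq ?hp.
by rewrite (res _ f) // (res _ g); do ?[exact: g0].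
Qed.

Variable R : rcfType.

(** A common zero z of p(tx) and q makes t z a zero w of p, so t = w / z is one of finitely many
    ratios; some positive integer avoids them. *)
Lemma coprimep_scale (p q : {poly R}) : p.[0] != 0 -> q.[0] != 0 ->
  exists2 t : R, 0 < t & coprimep (p \Po (t%:P * 'X)) q.
Proof.
move=> p0 q0.
have [ws ews] := closed_field_poly_normal (map_poly (real_complex R) p).
have [zs ezs] := closed_field_poly_normal (map_poly (real_complex R) q).
pose bad : seq R[i] := [seq w / z | w <- ws, z <- zs].
have [k kbad] : exists k : nat, k.+1%:R \notin bad.
  apply: contrapT => all_bad.
  have sub : {subset [seq k.+1%:R | k <- iota 0 (size bad).+1] <= bad}.
    by move=> _ /mapP[k _ ->]; apply/negPn/negP => kb; apply: all_bad; exists k.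
  have U : uniq [seq k.+1%:R : R[i] | k <- iota 0 (size bad).+1].
    rewrite map_inj_uniq ?iota_uniq // => i j /eqP.
    by rewrite eqr_nat => /eqP[].
  by have := uniq_leq_size U sub; rewrite size_map size_iota ltnn.
exists k.+1%:R; first by rewrite ltr0n.
rewrite -(coprimep_map (real_complex R)) map_comp_poly rmorphM /= map_polyX map_polyC /=.
apply/coprimepP => d dp dq; rewrite -size_poly_eq1.
apply/negPn/negP => /closed_rootP[z rz].
have dvd_root (r : {poly R[i]}) : d %| r -> root r z.
  by move: rz; rewrite -!dvdp_XsubCl; exact: dvdp_trans.
have rq := dvd_root _ dq.
have rp : root (map_poly (real_complex R) p) (k.+1%:R * z).
  have := dvd_root _ dp; rewrite /root horner_comp !hornerE /=.
  by rewrite rmorph_nat.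
have nz (r : {poly R}) : r.[0] != 0 -> lead_coef (map_poly (real_complex R) r) != 0.
  move=> r0; rewrite lead_coef_map fmorph_eq0 lead_coef_eq0.
  by apply: contraNneq r0 => ->; rewrite horner0.
rewrite ews rootZ ?nz // root_prod_XsubC in rp.
have z0 : z != 0.
  apply: contraNneq q0 => z0; move: rq; rewrite z0 /root.
  have -> : (0 : R[i]) = real_complex R 0 by rewrite rmorph0.
  by rewrite horner_map fmorph_eq0.
rewrite ezs rootZ ?nz // root_prod_XsubC in rq.
move/negP: kbad; apply; apply/allpairsP; exists (k.+1%:R * z, z); split=> //=.
by rewrite mulfK.
Qed.

End Coprimality.

(** * Division by the gcd, up to scalars *)

Section RemoveGcd.
Local Open Scope ring_scope.
Variable F : fieldType.
Implicit Types a b u w : {poly F} * {poly F}.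

Lemma proportional_div (g x p q : {poly F}) b (k : F) :
  x != 0 -> k != 0 -> g %= x -> p = k%:P * (x * b.1) -> q = k%:P * (x * b.2) ->
  proportional (p %/ g, q %/ g) b.
Proof.
move=> x0 k0 /eqpf_eq[c c0 ->] -> ->.
have e (r : {poly F}) : (k%:P * (x * r)) %/ (c *: x) = (k / c)%:P * r.
  have -> : k%:P * (x * r) = ((k / c)%:P * r) * (c *: x).
    by rewrite -mul_polyC -{1}(divfK c0 k) polyCM; ring.
  by rewrite mulpK // scaler_eq0 negb_or c0.
by exists (k / c); rewrite ?mulf_neq0 ?invr_eq0 // !e.
Qed.

Lemma parallel_remove_gcd a b u w : proportional u a -> proportional w b ->
  coprimep a.2 b.2 -> let g := gcdp u.2 w.2 in
  proportional ((u.1 * w.2 + u.2 * w.1) %/ g, (u.2 * w.2) %/ g)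
               (a.1 * b.2 + a.2 * b.1, a.2 * b.2).
Proof.
case=> k k0 eu [l l0 ew] cop g.
have [u1 u2] : u.1 = k%:P * a.1 /\ u.2 = k%:P * a.2 by rewrite eu.
have [w1 w2] : w.1 = l%:P * b.1 /\ w.2 = l%:P * b.2 by rewrite ew.
apply: (@proportional_div g 1 _ _ _ (k * l)); rewrite ?oner_neq0 ?mulf_neq0 //.
- by rewrite gcdp_eqp1 u2 w2 !mul_polyC coprimepZl // coprimepZr.
- by rewrite u1 u2 w1 w2 polyCM -[fst (_, _)]/(a.1 * b.2 + a.2 * b.1); ring.
- by rewrite u2 w2 polyCM -[snd (_, _)]/(a.2 * b.2); ring.
Qed.

(** The cofactors left after removing [x] are coprime and nonzero at 0, so the gcd is associated to
    [x] if both flags are set and to 1 otherwise. *)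
Lemma series_remove_gcd (zA zB : bool) a b u w :
  proportional u a -> proportional w b ->
  (zA -> a.1`_0 = 0) -> (zB -> b.1`_0 = 0) ->
  (drop_poly zA a.1)`_0 != 0 -> (drop_poly zB b.1)`_0 != 0 ->
  coprimep (drop_poly zA a.1) (drop_poly zB b.1) -> let g := gcdp u.1 w.1 in
  proportional ((u.1 * w.1) %/ g, (u.1 * w.2 + u.2 * w.1) %/ g) (series zA zB a b).
Proof.
case=> k k0 eu [l l0 ew] P0 Q0 Pn Qn cop g.
have [u1 u2] : u.1 = k%:P * a.1 /\ u.2 = k%:P * a.2 by rewrite eu.
have [w1 w2] : w.1 = l%:P * b.1 /\ w.2 = l%:P * b.2 by rewrite ew.
pose x : {poly F} := if zA && zB then 'X else 1.
apply: (@proportional_div g x _ _ _ (k * l)); rewrite ?mulf_neq0 //.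
- by rewrite /x; case: ifP => _; rewrite ?polyX_eq0 ?oner_neq0.
- rewrite /g u1 w1 !mul_polyC (eqp_trans (gcdp_scalel _ _ k0)) //.
  rewrite (eqp_trans (gcdp_scaler _ _ l0)) // /x.
  case: zA zB P0 Q0 Pn Qn cop {x} => -[] /=; rewrite ?drop_poly0l => P0 Q0 Pn Qn cop.
  + rewrite -(mulX_drop (P0 isT)) -(mulX_drop (Q0 isT)).
    rewrite (eqp_trans (gcdp_mul2l _ _ _)) // -[X in _ %= X]mulr1.
    by rewrite eqp_mul2l ?polyX_eq0 // gcdp_eqp1.
  + rewrite -(mulX_drop (P0 isT)) gcdp_eqp1 coprimepMl cop andbT coprimep_sym.
    by rewrite coprimepX /root horner_coef0.
  + rewrite -(mulX_drop (Q0 isT)) gcdp_eqp1 coprimepMr cop andbT.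
    by rewrite coprimepX /root horner_coef0.
  + by rewrite gcdp_eqp1.
- rewrite u1 w1; suff <- : a.1 * b.1 = x * drop_poly (zA && zB) (a.1 * b.1).
    by rewrite polyCM; ring.
  rewrite /x; case: (boolP (zA && zB)) => [/andP[/P0 a0 /Q0 b0]|_].
    by rewrite mulX_drop // coef0M a0 mul0r.
  by rewrite drop_poly0l mul1r.
- rewrite u1 u2 w1 w2.
  suff <- : a.1 * b.2 + a.2 * b.1 = x * drop_poly (zA && zB) (a.1 * b.2 + a.2 * b.1).
    by rewrite polyCM; ring.
  rewrite /x; case: (boolP (zA && zB)) => [/andP[/P0 a0 /Q0 b0]|_].
    by rewrite mulX_drop // coefD !coef0M a0 b0 mul0r mulr0 addr0.
  by rewrite drop_poly0l mul1r.
Qed.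

End RemoveGcd.

(** * Networks *)

Section NetworkPairs.
Local Open Scope ring_scope.
Variables N K : nat.
Implicit Types A B M : network N K.

(** Whether the compliance has a pole at 0. Compliances add in series, so one pole suffices; their
    inverses add in parallel, so both are needed. *)
Fixpoint zero_pole M : bool :=
  match M with
  | Spring _ => false
  | Dashpot _ => true
  | Par A B => zero_pole A && zero_pole B
  | Ser A B => zero_pole A || zero_pole B
  end.

(* The constitutive equation of a network over an arbitrary ring: for generic
   parameters the only common factor to be removed is [x]. *)
Fixpoint net_pair (S : comNzRingType) (v : 'I_N + 'I_K -> S) M :
    {poly S} * {poly S} :=
  match M with
  | Spring j => ((v (inl j))%:P, 1)
  | Dashpot k => ((v (inr k))%:P * 'X, 1)
  | Par A B =>
      let a := net_pair v A in let b := net_pair v B in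
      (a.1 * b.2 + a.2 * b.1, a.2 * b.2)
  | Ser A B => series (zero_pole A) (zero_pole B) (net_pair v A) (net_pair v B)
  end.

Section AnyRing.
Variables (S : comNzRingType) (v : 'I_N + 'I_K -> S).

Let x (b : bool) : {poly S} := if b then 'X else 1.

Lemma net_pair_coef0 M : zero_pole M -> (net_pair v M).1`_0 = 0.
Proof.
elim: M => //= [k _|A IHA B IHB /andP[/IHA a0 /IHB b0]|A IHA B IHB].
- by rewrite coefMX.
- by rewrite coefD !coef0M a0 b0 mul0r mulr0 addr0.
rewrite coef_drop_poly add0n; case: (zero_pole A) IHA => [/(_ isT) a0|_];
  case: (zero_pole B) IHB => [/(_ isT) b0|_] //= _.
- by rewrite coefM !big_ord_recr big_ord0 /= a0 b0 mul0r mulr0 !addr0.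
- by rewrite coef0M a0 mul0r.
- by rewrite coef0M b0 mulr0.
Qed.

Lemma net_pair_ser A B : let z := zero_pole A && zero_pole B in
  let a := net_pair v A in let b := net_pair v B in
  x z * (net_pair v (Ser A B)).1 = a.1 * b.1 /\
  x z * (net_pair v (Ser A B)).2 = a.1 * b.2 + a.2 * b.1.
Proof.
move=> z a b; rewrite /= /series -/z -/a -/b.
have [/andP[/net_pair_coef0 a0 /net_pair_coef0 b0]|_] := boolP z; last first.
  by rewrite !drop_poly0l !mul1r.
rewrite !mulX_drop //.
  by rewrite coefD !coef0M a0 b0 mul0r mulr0 addr0.
by rewrite coef0M a0 mul0r.
Qed.

(** In parallel the inverses 1 / J add, hence so do the duals 1 / (x J). Parallel connection is
    therefore series connection conjugated by duality. *)
Lemma net_pair_par A B :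
  net_pair v (Par A B) =
  dual (~~ zero_pole A || ~~ zero_pole B)
    (series (~~ zero_pole A) (~~ zero_pole B)
      (dual (zero_pole A) (net_pair v A)) (dual (zero_pole B) (net_pair v B))).
Proof.
rewrite /=; set a := net_pair v A; set b := net_pair v B.
have [zA|zA] := boolP (zero_pole A); have [zB|zB] := boolP (zero_pole B);
  rewrite /dual /series /= ?drop_poly0l.
- rewrite mulrDr mulrCA !mulX_drop ?net_pair_coef0 //.
  rewrite [in 'X * (drop_poly _ _ * _)]mulrA mulX_drop ?net_pair_coef0 //.
  by rewrite addrC.
- have -> : a.2 * ('X * b.2) = 'X * (a.2 * b.2) by ring.
  rewrite drop_poly1X.
  have -> : drop_poly 1 a.1 * ('X * b.2) = 'X * drop_poly 1 a.1 * b.2 by ring.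
  by rewrite mulX_drop ?net_pair_coef0 // addrC.
- have -> : 'X * a.2 * b.2 = 'X * (a.2 * b.2) by ring.
  rewrite drop_poly1X.
  have -> : 'X * a.2 * drop_poly 1 b.1 = a.2 * ('X * drop_poly 1 b.1) by ring.
  by rewrite mulX_drop ?net_pair_coef0 // addrC.
have -> : 'X * a.2 * ('X * b.2) = 'X * ('X * (a.2 * b.2)) by ring.
have -> : 'X * a.2 * b.1 + a.1 * ('X * b.2) = 'X * (a.1 * b.2 + a.2 * b.1) by ring.
by rewrite !drop_poly1X.
Qed.

Lemma mulXI : injective (fun p : {poly S} => 'X * p).
Proof. by move=> p q /(congr1 (drop_poly 1)); rewrite !drop_poly1X. Qed.

(** Both nestings remove the same total power of [x]; after multiplying it back the identity is
    polynomial, and multiplication by ['X] is injective over any ring. *)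
Lemma net_pair_serA A B C :
  net_pair v (Ser A (Ser B C)) = net_pair v (Ser (Ser A B) C).
Proof.
have [e1 e2] := net_pair_ser A (Ser B C); have [f1 f2] := net_pair_ser B C.
have [g1 g2] := net_pair_ser (Ser A B) C; have [h1 h2] := net_pair_ser A B.
set L := net_pair v (Ser A _) in e1 e2 *; set L' := net_pair v (Ser _ C) in g1 g2 *.
set BC := net_pair v (Ser B C) in e1 e2 f1 f2.
set AB := net_pair v (Ser A B) in g1 g2 h1 h2.
set y := x (zero_pole A && zero_pole (Ser B C)) in e1 e2.
set y' := x (zero_pole (Ser A B) && zero_pole C) in g1 g2.
set u := x (zero_pole B && zero_pole C) in f1 f2.
set u' := x (zero_pole A && zero_pole B) in h1 h2.
have yu : y * u = y' * u'.
  rewrite /y /u /y' /u' /=.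
  by case: (zero_pole A); case: (zero_pole B); case: (zero_pole C);
    rewrite /= ?mulr1 ?mul1r.
have yuI : injective (fun p => y * u * p).
  rewrite /y /u; case: (_ && _); case: (_ && _) => p q /=.
  - by rewrite -!mulrA => /mulXI /mulXI.
  - by rewrite mulr1 => /mulXI.
  - by rewrite mul1r => /mulXI.
  - by rewrite !mul1r.
rewrite [L]surjective_pairing [L']surjective_pairing; congr (_, _); apply: yuI.
  have -> : y * u * L.1 = u * (y * L.1) by ring.
  rewrite e1 yu.
  have -> : y' * u' * L'.1 = u' * (y' * L'.1) by ring.
  rewrite g1.
  have -> : u * ((net_pair v A).1 * BC.1) = (net_pair v A).1 * (u * BC.1) by ring.
  rewrite f1.
  have -> : u' * (AB.1 * (net_pair v C).1) = (u' * AB.1) * (net_pair v C).1 by ring.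
  by rewrite h1; ring.
have -> : y * u * L.2 = u * (y * L.2) by ring.
rewrite e2 yu.
have -> : y' * u' * L'.2 = u' * (y' * L'.2) by ring.
rewrite g2.
have -> : u * ((net_pair v A).1 * BC.2 + (net_pair v A).2 * BC.1) =
  (net_pair v A).1 * (u * BC.2) + (net_pair v A).2 * (u * BC.1) by ring.
rewrite f1 f2.
have -> : u' * (AB.1 * (net_pair v C).2 + AB.2 * (net_pair v C).1) =
  (u' * AB.1) * (net_pair v C).2 + (u' * AB.2) * (net_pair v C).1 by ring.
by rewrite h1 h2; ring.
Qed.

End AnyRing.

Lemma net_eq_params A B : net_eq A B -> perm_eq (params A) (params B).
Proof.
elim=> {A B} //=.
- by move=> A B _; rewrite perm_sym.
- by move=> A B C _ h1 _; exact: perm_trans.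
- by move=> A A' B B' _ h1 _ h2; exact: perm_cat.
- by move=> A A' B B' _ h1 _ h2; exact: perm_cat.
- by move=> A B; rewrite perm_catC.
- by move=> A B; rewrite perm_catC.
- by move=> A B C; rewrite catA.
- by move=> A B C; rewrite catA.
Qed.

Lemma net_eq_network A B : net_eq A B -> is_network A = is_network B.
Proof. by move/net_eq_params/perm_uniq. Qed.

Lemma net_eq_pair A B : net_eq A B -> zero_pole A = zero_pole B /\
  forall (S : comNzRingType) (v : 'I_N + 'I_K -> S), net_pair v A = net_pair v B.
Proof.
elim=> {A B}.
- by [].
- by move=> A B _ [z p]; split.
- by move=> A B C _ [z p] _ [z' p']; split; [rewrite z | move=> S v; rewrite p].
- by move=> A A' B B' _ [z p] _ [z' p']; split=> [|S v] /=; rewrite ?z ?z' ?p ?p'.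
- by move=> A A' B B' _ [z p] _ [z' p']; split=> [|S v] /=; rewrite ?z ?z' ?p ?p'.
- move=> A B; split=> [|S v] /=; first by rewrite andbC.
  by congr (_, _); ring.
- move=> A B; split=> [|S v] /=; first by rewrite orbC.
  exact: seriesC.
- move=> A B C; split=> [|S v] /=; first by rewrite andbA.
  by congr (_, _); ring.
- move=> A B C; split=> [|S v]; first by rewrite /= orbA.
  exact: net_pair_serA.
Qed.

Lemma one_at_a_time_basic M : is_basic M -> one_at_a_time M.
Proof.
move=> bM; exists 1%N, (fun=> M); split=> //; first exact: net_refl.
  by move=> i _; rewrite /is_network; case: M bM.
by move=> i; rewrite ltnS => /andP[i0]; rewrite leqNgt i0.
Qed.

Lemma one_at_a_time_net_eq A B : net_eq A B -> one_at_a_time A -> one_at_a_time B.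
Proof.
move=> AB [r [Ms [r0 b1 eA nM step]]]; exists r, Ms; split=> //.
exact: net_trans eA AB.
Qed.

Lemma one_at_a_time_step A M b : one_at_a_time A -> is_basic b -> is_network M ->
  M = Par A b \/ M = Ser A b -> one_at_a_time M.
Proof.
move=> [r [Ms [r0 b1 eA nM step]]] bb nwM eM.
exists r.+1, (fun i => if (i <= r)%N then Ms i else M); split=> //.
- by rewrite r0.
- by rewrite ltnn; exact: net_refl.
- by move=> i /andP[i0 ir]; case: ifP => // ir'; apply: nM; rewrite i0.
move=> i /andP[i0]; rewrite ltnS => ir; rewrite ir.
move: ir; rewrite leq_eqVlt => /predU1P[->|ir]; last first.
  by rewrite ir; apply: step; rewrite i0.
rewrite ltnn; exists b; split=> //.
by case: eM => ->; [left; apply: net_par | right; apply: net_ser];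
  try exact: net_refl; exact: net_sym.
Qed.

End NetworkPairs.

(** * Identifiability of compliances and one-at-a-time construction *)

Section NetworkDichotomy.
Local Open Scope ring_scope.
Variables (R : rcfType) (N K : nat).
Implicit Types (A B M : network N K) (n : nat) (a z : bool).

Definition compliance M (v : 'I_N + 'I_K -> R) := net_pair v M.

Lemma depends_on_compliance M : depends_on (params M) (compliance M).
Proof.
elim: M => [j|k|A IHA B IHB|A IHA B IHB] v w vw; rewrite /compliance /=.
- by rewrite vw // mem_head.
- by rewrite vw // mem_head.
all: rewrite -/(compliance A v) -/(compliance B v) -/(compliance A w) -/(compliance B w).
all: by rewrite (IHA v w) ?(IHB v w) // => p pM; apply: vw; rewrite mem_cat pM ?orbT.
Qed.

(** A spring has the constant compliance 1 / E; a dashpot has 1 / (eta x), with a single pole at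
    0. *)
Lemma universal_basic b : is_basic b ->
  universal (params b) (compliance b) 0 (~~ zero_pole b) (zero_pole b).
Proof.
case: b => // [j|k] _; split=> //.
- move=> v v0; exists (v (inl j)), (v (inl j))^-1, [::].
  have v1 := v0 (inl j); split; first by rewrite gt_eqF.
    by rewrite /spectral /= invr_ge0 (ltW v1) invr_eq0 (gt_eqF v1).
  by rewrite /compliance /= /den big_nil mulr1 -polyCM mulfV ?gt_eqF.
- move=> e [k [c [s [k0 sp ->]]]].
  have [_ _ /= es] := spectral0 sp erefl; rewrite es in sp *.
  move: sp => /and5P[c0 /eqP cn _ _ _]; have c1 : 0 < c by rewrite lt0r cn c0.
  exists (fun=> c^-1); first by move=> p; rewrite invr_gt0.
  exists (k * c)^-1; first by rewrite invr_eq0 mulf_neq0 // gt_eqF.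
  rewrite /compliance /= /den big_nil mulr1 -!polyCM.
  congr (_%:P, _); last by rewrite mulVf // mulf_neq0 // gt_eqF.
  by rewrite invfM -mulrA mulrCA mulVf // mulr1.
- move=> v w v0 w0 [k k0 [e1 e2]] p; rewrite inE => /eqP ->.
  move: e1 e2; rewrite mulr1 -polyCM => /polyC_inj -> /esym/eqP.
  by rewrite -[X in _ == X]polyC1 (inj_eq polyC_inj) => /eqP ->; rewrite mul1r.
- move=> v v0; exists (v (inr k)), 0, [:: (0, (v (inr k))^-1)].
  have v1 := v0 (inr k); split; first by rewrite gt_eqF.
    by rewrite /spectral /= !lexx eqxx /= invr_gt0 v1 mem_head.
  rewrite /compliance /= den_cons /den big_nil /= subr0 polyC0 !mulr1 mulr0 add0r.
  by rewrite -polyCM mulfV ?gt_eqF.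
- move=> e [l [c [s [l0 sp ->]]]].
  have [r r0 /= es] := spectral0 sp erefl; rewrite es in sp *.
  move: sp => /and5P[_ /eqP/negbFE/eqP -> _ _ _].
  exists (fun=> r^-1); first by move=> p; rewrite invr_gt0.
  exists (l * r)^-1; first by rewrite invr_eq0 mulf_neq0 // gt_eqF.
  rewrite /compliance /= den_cons /den big_nil /= subr0 polyC0 !mulr1 mulr0 add0r.
  rewrite !mulrA -!polyCM; congr (_%:P * _, _).
    by rewrite invfM -mulrA mulrCA mulVf // mulr1.
  by rewrite -mulrA mulVf // mulf_neq0 // gt_eqF.
- move=> v w v0 w0 [l l0 [e1 e2]] p; rewrite inE => /eqP ->.
  move: e1 e2; rewrite mulr1 mulrA -polyCM => /(mulIf (negbT (polyX_eq0 _))).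
  move=> /polyC_inj -> /esym/eqP.
  by rewrite -[X in _ == X]polyC1 (inj_eq polyC_inj) => /eqP ->; rewrite mul1r.
Qed.

Lemma network_disjoint A B : uniq (params A ++ params B) ->
  [/\ is_network A, is_network B & ~~ has (mem (params A)) (params B)].
Proof. by rewrite cat_uniq => /and3P[]. Qed.

Lemma ser_trichotomy A B nA nB aA aB : is_network (Ser A B) ->
  universal (params A) (compliance A) nA aA (zero_pole A) ->
  universal (params B) (compliance B) nB aB (zero_pole B) ->
  let M := Ser A B in
  [\/ infinitely_ambiguous (params M) (compliance M),
      [/\ (0 < nA)%N, (0 < nB)%N & ambiguous (params M) (compliance M)] |
      [/\ (nA == 0%N) || (nB == 0%N), ~~ (aA && aB), ~~ (zero_pole A && zero_pole B) &
          universal (params M) (compliance M) (nA + nB)%N (aA || aB) (zero_pole M)]].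
Proof.
move=> /network_disjoint[_ _ disj] UA UB.
exact (series_trichotomy disj (@depends_on_compliance A) (@depends_on_compliance B) UA UB).
Qed.

(** The series trichotomy applied to the dual families, then dualized back; [nA'] and [nB'] count
    the nonzero poles of the duals. *)
Lemma par_trichotomy A B nA nB aA aB : is_network (Par A B) ->
  let zA := zero_pole A in let zB := zero_pole B in
  universal (params A) (compliance A) nA aA zA ->
  universal (params B) (compliance B) nB aB zB ->
  let M := Par A B in let nA' := (nA + aA + zA).-1 in let nB' := (nB + aB + zB).-1 in
  let a' := ~~ aA || ~~ aB in let z' := ~~ zA || ~~ zB in
  [\/ infinitely_ambiguous (params M) (compliance M),
      [/\ (0 < nA')%N, (0 < nB')%N & ambiguous (params M) (compliance M)] |
      [/\ (nA' == 0%N) || (nB' == 0%N), aA || aB, zA || zB &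
          universal (params M) (compliance M) (nA' + nB' + a' + z').-1%N (~~ a') (~~ z')]].
Proof.
move=> /network_disjoint[_ _ disj] zA zB UA UB M nA' nB' a' z'.
have dual_dep X z : depends_on (params X) (dual z \o compliance X).
  by move=> v w vw; rewrite /= (@depends_on_compliance X v w vw).
pose h v := series (~~ zA) (~~ zB) (dual zA (compliance A v)) (dual zB (compliance B v)).
have hM : dual z' \o h =1 compliance M.
  by move=> v; rewrite /compliance net_pair_par.
have := series_trichotomy disj (dual_dep A zA) (dual_dep B zB)
  (universal_dual UA) (universal_dual UB).
rewrite -/h => -[amb|[nA0 nB0 amb]|[n0 aAB zAB U]].
- constructor 1; apply: infinitely_ambiguous_transfer amb => // v w.
  by rewrite -!hM => p _; exact: proportional_dual.
- constructor 2; split=> //; apply: ambiguous_transfer amb => // v w.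
  by rewrite -!hM => p _; exact: proportional_dual.
constructor 3; split=> //.
- by move: aAB; case: (aA); case: (aB).
- by move: zAB; case: (zA); case: (zB).
by apply: universal_ext (universal_dual U).
Qed.

(* Networks with at most two parameters are determined by their spectral type. *)
Definition small_shape M n a z : Prop :=
  [/\ n = 0%N -> a (+) z -> is_basic M,
      n = 0%N -> a && z ->
        exists b1 b2, [/\ is_basic b1, is_basic b2 & M = Ser b1 b2] &
      n = 1%N -> ~~ (a || z) ->
        exists b1 b2, [/\ is_basic b1, is_basic b2 & M = Par b1 b2]].

Lemma proportional_par A B v w :
  proportional (compliance A w) (compliance A v) ->
  proportional (compliance B w) (compliance B v) ->
  proportional (compliance (Par A B) w) (compliance (Par A B) v).
Proof.
rewrite /compliance /=.
case=> k k0 -> [l l0 ->]; exists (k * l); first by rewrite mulf_neq0.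
by rewrite /= polyCM; congr (_, _); ring.
Qed.

Section Subnetworks.
Variables A B M : network N K.
Hypothesis nwM : is_network M.
Hypothesis eM : M = Par A B \/ M = Ser A B.

Lemma composed_params : params M = params A ++ params B.
Proof. by case: eM => ->. Qed.

Lemma subnetwork_transfer v w :
  (proportional (compliance A w) (compliance A v) /\ off (params A) v w) \/
  (proportional (compliance B w) (compliance B v) /\ off (params B) v w) ->
  proportional (compliance M w) (compliance M v).
Proof.
have [_ _ disj] : [/\ is_network A, is_network B & ~~ has (mem (params A)) (params B)].
  by apply: network_disjoint; rewrite -composed_params.
move=> AB; have [pA pB] : proportional (compliance A w) (compliance A v) /\
    proportional (compliance B w) (compliance B v).
  case: AB => -[p o]; split=> //.
    rewrite (@depends_on_compliance B w v); first exact: proportional_refl.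
    by move=> q qB; apply: o; apply: contra disj => qA; apply/hasP; exists q.
  rewrite (@depends_on_compliance A w v); first exact: proportional_refl.
  by move=> q qA; apply: o; apply: contra disj => qB; apply/hasP; exists q.
by case: eM => ->; [exact: proportional_par | exact: proportional_series].
Qed.

Lemma ambiguous_sub : ambiguous (params A) (compliance A) \/
  ambiguous (params B) (compliance B) -> ambiguous (params M) (compliance M).
Proof.
case=> amb; apply: ambiguous_transfer amb.
- by move=> p; rewrite composed_params mem_cat => ->.
- by move=> v w p o; apply: subnetwork_transfer; left.
- by move=> p; rewrite composed_params mem_cat orbC => ->.
- by move=> v w p o; apply: subnetwork_transfer; right.
Qed.

Lemma infinitely_ambiguous_sub : infinitely_ambiguous (params A) (compliance A) ->
  infinitely_ambiguous (params M) (compliance M).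
Proof.
move=> amb; apply: infinitely_ambiguous_transfer amb => [p|v w p o].
  by rewrite composed_params mem_cat => ->.
by apply: subnetwork_transfer; left.
Qed.

End Subnetworks.

(** Without nonzero poles, [B] is an element or a series of two elements; in the second case
    associativity allows them to be added in turn. *)
Lemma one_at_a_time_ser A B n a : is_network (Ser A B) ->
  (0 < n + a + zero_pole B)%N -> small_shape B n a (zero_pole B) -> n = 0%N ->
  one_at_a_time A -> one_at_a_time (Ser A B).
Proof.
move=> nw dim [s1 s2 _] n0 oA; rewrite n0 in dim s1 s2.
have [az|az] := boolP (a && zero_pole B).
  have [b1 [b2 [bb1 bb2 eB]]] := s2 erefl az.
  have e : net_eq (Ser (Ser A b1) b2) (Ser A B).
    by rewrite eB; apply: net_sym; exact: net_serA.
  have nw' : is_network (Ser (Ser A b1) b2) by rewrite (net_eq_network e).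
  apply: (one_at_a_time_net_eq e).
  apply: (one_at_a_time_step (A := Ser A b1) (b := b2)) => //; last by right.
  apply: (one_at_a_time_step oA bb1); last by right.
  by have [] := @network_disjoint (Ser A b1) b2 nw'.
apply: (one_at_a_time_step oA _ nw); last by right.
by apply: s1 => //; move: az dim; case: (a); case: (zero_pole B).
Qed.

(** Dually, if the dual of [B] has no nonzero pole, [B] is an element or two elements in
    parallel. *)
Lemma one_at_a_time_par A B n a : is_network (Par A B) ->
  (0 < n + a + zero_pole B)%N -> small_shape B n a (zero_pole B) ->
  (n + a + zero_pole B).-1 = 0%N ->
  one_at_a_time A -> one_at_a_time (Par A B).
Proof.
move=> nw dim [s1 _ s3] n0 oA.
have [az|az] := boolP (a || zero_pole B).
  apply: (one_at_a_time_step oA _ nw); last by left.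
  apply: s1; first by move: az n0; case: (a); case: (zero_pole B) => //=; lia.
  by move: az n0; case: (a); case: (zero_pole B) => //=; lia.
have [b1 [b2 [bb1 bb2 eB]]] : exists b1 b2,
    [/\ is_basic b1, is_basic b2 & B = Par b1 b2].
  by apply: s3 => //; move: az dim n0; case: (a); case: (zero_pole B) => //=; lia.
have e : net_eq (Par (Par A b1) b2) (Par A B).
  by rewrite eB; apply: net_sym; exact: net_parA.
have nw' : is_network (Par (Par A b1) b2) by rewrite (net_eq_network e).
apply: (one_at_a_time_net_eq e).
apply: (one_at_a_time_step (A := Par A b1) (b := b2)) => //; last by left.
apply: (one_at_a_time_step oA bb1); last by left.
by have [] := @network_disjoint (Par A b1) b2 nw'.
Qed.

(** Induction on the tree. Ambiguity of a part passes to the whole; otherwise the trichotomy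
    applies, and its third case provides a part that [small_shape] allows to be attached element by
    element. *)
Lemma ambiguous_or_one_at_a_time M : is_network M ->
  (exists n a, [/\ universal (params M) (compliance M) n a (zero_pole M),
                   small_shape M n a (zero_pole M) & one_at_a_time M]) \/
  ambiguous (params M) (compliance M).
Proof.
have basic b : is_basic b ->
  exists n a, [/\ universal (params b) (compliance b) n a (zero_pole b),
                  small_shape b n a (zero_pole b) & one_at_a_time b].
  move=> bb; exists 0%N, (~~ zero_pole b); split; last exact: one_at_a_time_basic.
    exact: universal_basic.
  by split=> //; case: (zero_pole b).
elim: M => [j|k|A IHA B IHB|A IHA B IHB] nw; first by left; exact: basic.
- by left; exact: basic.
- have [nwA nwB disj] := @network_disjoint A B nw.
  have eM : Par A B = Par A B \/ Par A B = Ser A B by left.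
  have [[nA [aA [UA sA oA]]]|amb] := IHA nwA; last first.
    by right; apply: (ambiguous_sub nw eM); left.
  have [[nB [aB [UB sB oB]]]|amb] := IHB nwB; last first.
    by right; apply: (ambiguous_sub nw eM); right.
  have dA := universal_dim UA; have dB := universal_dim UB.
  have [amb|[_ _ amb]|[n0 aAB zAB U]] := par_trichotomy nw UA UB.
  - by right; exact: infinitely_ambiguousW.
  - by right.
  left; exists ((nA + aA + zero_pole A).-1 + (nB + aB + zero_pole B).-1 +
     (~~ aA || ~~ aB) + (~~ zero_pole A || ~~ zero_pole B)).-1, (aA && aB).
  rewrite -!negb_and !negbK in U *; split=> //.
    have [s1 _ _] := sA; have [t1 _ _] := sB.
    (* Counting rules out the first two shapes for a parallel connection; in the third, both parts
       are basic. *)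
    split=> /=.
    + move: dA dB n0 aAB zAB {U s1 t1 UA UB sA sB}.
      by case: (aA); case: (aB); case: (zero_pole A); case: (zero_pole B) => //=; lia.
    + move: dA dB n0 aAB zAB {U s1 t1 UA UB sA sB}.
      by case: (aA); case: (aB); case: (zero_pole A); case: (zero_pole B) => //=; lia.
    + move=> n1 az; exists A, B; split=> //.
        apply: s1; move: n1 az dA dB n0 aAB zAB {U t1 UA UB sA sB};
        by case: (aA); case: (aB); case: (zero_pole A); case: (zero_pole B) => //=; lia.
      apply: t1; move: n1 az dA dB n0 aAB zAB {U s1 UA UB sA sB};
      by case: (aA); case: (aB); case: (zero_pole A); case: (zero_pole B) => //=; lia.
  case/orP: n0 => /eqP n0; last exact: one_at_a_time_par nw dB sB n0 oA.
  apply: (one_at_a_time_net_eq (net_parC B A)).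
  apply: one_at_a_time_par dA sA n0 oB.
  by rewrite (net_eq_network (net_parC B A)).
have [nwA nwB disj] := @network_disjoint A B nw.
have eM : Ser A B = Par A B \/ Ser A B = Ser A B by right.
have [[nA [aA [UA sA oA]]]|amb] := IHA nwA; last first.
  by right; apply: (ambiguous_sub nw eM); left.
have [[nB [aB [UB sB oB]]]|amb] := IHB nwB; last first.
  by right; apply: (ambiguous_sub nw eM); right.
have dA := universal_dim UA; have dB := universal_dim UB.
have [amb|[_ _ amb]|[n0 aAB zAB U]] := ser_trichotomy nw UA UB.
- by right; exact: infinitely_ambiguousW.
- by right.
left; exists (nA + nB)%N, (aA || aB); split=> //.
  have [s1 _ _] := sA; have [t1 _ _] := sB.
  split=> /=.
  + move: dA dB n0 aAB zAB {U s1 t1 UA UB sA sB}.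
    by case: (aA); case: (aB); case: (zero_pole A); case: (zero_pole B) => //=; lia.
  + move=> n1 az; exists A, B; split=> //.
      apply: s1; move: n1 az dA dB n0 aAB zAB {U t1 UA UB sA sB};
      by case: (aA); case: (aB); case: (zero_pole A); case: (zero_pole B) => //=; lia.
    apply: t1; move: n1 az dA dB n0 aAB zAB {U s1 UA UB sA sB};
    by case: (aA); case: (aB); case: (zero_pole A); case: (zero_pole B) => //=; lia.
  + move: dA dB n0 aAB zAB {U s1 t1 UA UB sA sB}.
    by case: (aA); case: (aB); case: (zero_pole A); case: (zero_pole B) => //=; lia.
case/orP: n0 => /eqP n0; last exact: one_at_a_time_ser nw dB sB n0 oA.
apply: (one_at_a_time_net_eq (net_serC B A)).
apply: one_at_a_time_ser dA sA n0 oB.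
by rewrite (net_eq_network (net_serC B A)).
Qed.

(** Induction along the construction. Neither an element nor its dual has a nonzero pole, so pole
    swapping, which gives only one further point, never occurs; infinite ambiguity persists once it
    appears. *)
Lemma universal_or_infinitely_ambiguous M : one_at_a_time M ->
  (exists n a, universal (params M) (compliance M) n a (zero_pole M)) \/
  infinitely_ambiguous (params M) (compliance M).
Proof.
have transport A B : net_eq A B ->
  (exists n a, universal (params A) (compliance A) n a (zero_pole A)) \/
  infinitely_ambiguous (params A) (compliance A) ->
  (exists n a, universal (params B) (compliance B) n a (zero_pole B)) \/
  infinitely_ambiguous (params B) (compliance B).
  move=> AB; have pAB := perm_mem (net_eq_params AB).
  have [zAB cAB] := net_eq_pair AB.
  case=> [[n [a U]]|amb]; [left; exists n, a; rewrite -zAB | right].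
    by apply: universal_ext U => // v; exact: cAB.
  by apply: infinitely_ambiguous_ext amb => // v; exact: cAB.
case=> r [Ms [r0 b1 eM nw step]]; apply: (transport _ _ eM).
have Ms_ok i : (0 < i <= r)%N ->
    (exists n a, universal (params (Ms i)) (compliance (Ms i)) n a (zero_pole (Ms i))) \/
    infinitely_ambiguous (params (Ms i)) (compliance (Ms i)); last first.
  by apply: Ms_ok; rewrite r0 leqnn.
elim: i => // i IH /andP[_ ir].
have [->|i0] := posnP i.
  by left; exists 0%N, (~~ zero_pole (Ms 1%N)); exact: universal_basic.
have [|b [bb eb]] := step i; first by rewrite i0.
have Ub := universal_basic bb.
have [|[n [a U]]|amb] := IH; first by rewrite i0 ltnW.
- have nwi : is_network (Ms i.+1) by apply: nw.
  case: eb => eb; apply: (transport _ _ (net_sym eb)); rewrite (net_eq_network eb) in nwi.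
    have [amb|[_ n0 _]|[_ _ _ U']] := par_trichotomy nwi U Ub; first by right.
      by move: n0; case: (zero_pole b).
    left; rewrite -!negb_and !negbK in U'; do 2!eexists; exact: U'.
  have [amb|[_ n0 _]|[_ _ _ U']] := ser_trichotomy nwi U Ub; first by right.
    by [].
  by left; do 2!eexists; exact: U'.
have nwi : is_network (Ms i.+1) by apply: nw.
case: eb => eb; apply: (transport _ _ (net_sym eb)); right;
  rewrite (net_eq_network eb) in nwi; apply: (infinitely_ambiguous_sub nwi _ amb).
  by left.
by right.
Qed.

End NetworkDichotomy.

(** * The constitutive equation *)

Section PairMorphism.
Local Open Scope ring_scope.
Variables N K : nat.
Implicit Types A B M : network N K.

Lemma map_drop_poly (S S' : comNzRingType) (f : {rmorphism S -> S'}) m p :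
  map_poly f (drop_poly m p) = drop_poly m (map_poly f p).
Proof. by apply/polyP => i; rewrite coef_map !coef_drop_poly coef_map. Qed.

Lemma map_net_pair (S S' : comNzRingType) (f : {rmorphism S -> S'})
    (v : 'I_N + 'I_K -> S) M :
  net_pair (f \o v) M =
  (map_poly f (net_pair v M).1, map_poly f (net_pair v M).2).
Proof.
elim: M => [j|k|A IHA B IHB|A IHA B IHB] /=.
- by rewrite map_polyC rmorph1.
- by rewrite rmorphM /= map_polyC map_polyX rmorph1.
- by rewrite IHA IHB /= !rmorphD !rmorphM.
- by rewrite IHA IHB /series /= !map_drop_poly !rmorphD !rmorphM.
Qed.

Section PositiveParameters.
Variables (R : realDomainType) (v : 'I_N + 'I_K -> R).
Hypothesis v0 : forall p, 0 < v p.

(** These coefficients are sums of products of positive numbers, so nothing cancels: the first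
    polynomial vanishes at 0 to order exactly [zero_pole M], and the second does not vanish
    there. *)
Lemma net_pair_low_coef_gt0 M :
  0 < (net_pair v M).1`_(zero_pole M) /\ 0 < (net_pair v M).2`_0.
Proof.
have c0 := @net_pair_coef0 N K R v.
elim: M => [j|k|A [pA qA] B [pB qB]|A [pA qA] B [pB qB]] /=.
- by rewrite coefC coef1 v0.
- by rewrite coefCM coefX mulr1 coef1 v0.
- rewrite coef0M mulr_gt0 //; split=> //.
  have := c0 A; have := c0 B; move: pA pB.
  case: (zero_pole A) => pA; case: (zero_pole B) => pB /= cB cA; rewrite coefD.
  + rewrite !coefM !big_ord_recr !big_ord0 /= !add0r cA // cB // !mul0r add0r mulr0 addr0.
    by rewrite addr_gt0 ?mulr_gt0.
  + by rewrite !coef0M cA // mul0r add0r mulr_gt0.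
  + by rewrite !coef0M cB // mulr0 addr0 mulr_gt0.
  + by rewrite !coef0M addr_gt0 ?mulr_gt0.
rewrite !coef_drop_poly.
have := c0 A; have := c0 B; move: pA pB.
case: (zero_pole A) => pA; case: (zero_pole B) => pB /= cB cA;
  rewrite ?coefD ?coef0M.
+ rewrite !coefM !big_ord_recr !big_ord0 /= !add0r cA // cB //.
  by rewrite !mul0r !add0r !mulr0 !addr0 mulr_gt0 // addr_gt0 ?mulr_gt0.
+ rewrite coefM !big_ord_recr big_ord0 /= !add0r cA // mul0r add0r mulr_gt0 //.
  by rewrite mul0r add0r mulr_gt0.
+ rewrite coefM !big_ord_recr big_ord0 /= !add0r cB // mulr0 addr0 mulr_gt0 //.
  by rewrite mulr0 addr0 mulr_gt0.
+ by rewrite mulr_gt0 // addr_gt0 ?mulr_gt0.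
Qed.

End PositiveParameters.

(* Multiplying the dashpot constants by [t] amounts to a change of time scale. *)
Lemma net_pair_scale (R : fieldType) (v : 'I_N + 'I_K -> R) (t : R) M : t != 0 ->
  exists2 k : R, k != 0 &
  net_pair (fun p => if p is inr _ then t * v p else v p) M =
  (k%:P * ((net_pair v M).1 \Po (t%:P * 'X)),
   k%:P * ((net_pair v M).2 \Po (t%:P * 'X))).
Proof.
pose w p := if p is inr _ then t * v p else v p; rewrite -/w => t0.
elim: M => [j|k|A [a a0 eA] B [b b0 eB]|A [a a0 eA] B [b b0 eB]].
- exists 1; first exact: oner_neq0.
  by rewrite /= polyC1 !mul1r -polyC1 !comp_polyC.
- exists 1; first exact: oner_neq0.
  rewrite /= polyC1 !mul1r -polyC1 !comp_polyM !comp_polyC comp_polyX polyCM.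
  by congr (_, _); ring.
- exists (a * b); rewrite ?mulf_neq0 //= eA eB /= comp_polyD !comp_polyM polyCM.
  by congr (_, _); ring.
pose z := zero_pole A && zero_pole B.
(* The removed factor [x] becomes [t x] under the change of time scale, which contributes the extra
   [t] to the scalar. *)
pose x : {poly R} := if z then 'X else 1.
have x0 : x != 0 by rewrite /x; case: (z); rewrite ?polyX_eq0 ?oner_neq0.
have xt : (x \Po (t%:P * 'X)) = (if z then t else 1)%:P * x.
  by rewrite /x; case: (z); rewrite ?comp_polyX // polyC1 comp_polyC mul1r.
exists (a * b * (if z then t else 1)).
  by rewrite !mulf_neq0 //; case: (z); rewrite ?oner_neq0.
have [f1 f2] := net_pair_ser w A B; have [g1 g2] := net_pair_ser v A B.
rewrite -/z -/x in f1 f2 g1 g2.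
have cE (p q r : {poly R}) : x * q = r -> (r \Po (t%:P * 'X)) * (a * b)%:P = x * p ->
    p = (a * b * (if z then t else 1))%:P * (q \Po (t%:P * 'X)).
  move=> <-; rewrite comp_polyM xt => e; apply: (mulfI x0); rewrite -e !polyCM.
  by ring.
rewrite [LHS]surjective_pairing; congr (_, _).
  apply: (cE _ _ _ g1); rewrite f1 eA eB /= comp_polyM polyCM; ring.
apply: (cE _ _ _ g2); rewrite f2 eA eB /= comp_polyD !comp_polyM polyCM; ring.
Qed.

End PairMorphism.

Section ConstitutivePair.
Local Open Scope ring_scope.
Variables (R : rcfType) (N K : nat).
Implicit Types A B M : network N K.

Local Notation D := (mpoly (N + K) R).
Local Notation F := {fraction D}.

Definition mvar (p : 'I_N + 'I_K) : D := mpolyX R (mnm1 (unsplit p)).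

Definition valuation (theta : 'I_(N + K) -> R) (p : 'I_N + 'I_K) := theta (unsplit p).

Lemma mvar_eval theta M : net_pair (valuation theta) M =
  (map_poly (meval theta) (net_pair mvar M).1,
   map_poly (meval theta) (net_pair mvar M).2).
Proof.
rewrite -(map_net_pair (meval theta)); congr net_pair.
by apply/funext => p; rewrite /= mevalXU.
Qed.

(** A property preserved by sums and products. It makes a nonzero coefficient nonvanishing at every
    point of [Theta], not only at almost every point. *)
Definition zero_or_pos (m : D) : Prop :=
  m = 0 \/ forall theta, (forall i, 0 < theta i) -> 0 < meval theta m.

Lemma zero_or_posD m m' : zero_or_pos m -> zero_or_pos m' -> zero_or_pos (m + m').
Proof.
case=> [->|m0]; first by rewrite add0r.
case=> [->|m0']; first by rewrite addr0; right.
by right=> theta h; rewrite mevalD addr_gt0 ?m0 ?m0'.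
Qed.

Lemma zero_or_posM m m' : zero_or_pos m -> zero_or_pos m' -> zero_or_pos (m * m').
Proof.
case=> [->|m0]; first by rewrite mul0r; left.
case=> [->|m0']; first by rewrite mulr0; left.
by right=> theta h; rewrite mevalM mulr_gt0 ?m0 ?m0'.
Qed.

Lemma zero_or_pos1 : zero_or_pos 1.
Proof. by right=> theta h; rewrite meval1. Qed.

Lemma zero_or_pos_coef M i : zero_or_pos (net_pair mvar M).1`_i /\
  zero_or_pos (net_pair mvar M).2`_i.
Proof.
have pM (p q : {poly D}) : (forall i, zero_or_pos p`_i) ->
    (forall i, zero_or_pos q`_i) -> forall i, zero_or_pos (p * q)`_i.
  move=> hp hq j; rewrite coefM; elim/big_ind: _; first by left.
    exact: zero_or_posD.
  by move=> k _; exact: zero_or_posM.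
have pC (m : D) : zero_or_pos m -> forall i, zero_or_pos (m%:P : {poly D})`_i.
  by move=> hm j; rewrite coefC; case: ifP => // _; left.
have pX j : zero_or_pos ('X : {poly D})`_j.
  by rewrite coefX; case: eqP => _; [exact: zero_or_pos1 | left].
have pv p : zero_or_pos (mvar p) by right=> theta h; rewrite mevalXU.
have p1 := pC _ zero_or_pos1.
suff h : (forall i, zero_or_pos (net_pair mvar M).1`_i) /\
  (forall i, zero_or_pos (net_pair mvar M).2`_i) by split; apply h.
elim: M {i} => [j|k|A [a1 a2] B [b1 b2]|A [a1 a2] B [b1 b2]] /=.
- by split; [exact/pC/pv | rewrite -polyC1].
- by split; [apply: pM; [exact/pC/pv | exact: pX] | rewrite -polyC1].
- by split=> i; rewrite ?coefD; [apply: zero_or_posD|]; apply: pM.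
- by split=> i; rewrite coef_drop_poly ?coefD; [|apply: zero_or_posD]; apply: pM.
Qed.

Lemma eval_lead_coef theta M : (forall i, 0 < theta i) ->
  0 < meval theta (lead_coef (net_pair mvar M).1) /\
  0 < meval theta (lead_coef (net_pair mvar M).2).
Proof.
move=> h; have [l1 l2] : lead_coef (net_pair mvar M).1 != 0 /\
    lead_coef (net_pair mvar M).2 != 0.
  have [] := net_pair_low_coef_gt0 (v := valuation theta) _ M.
    by move=> p; exact: h.
  rewrite mvar_eval /= !lead_coef_eq0 !coef_map /= => p0 q0.
  by split; [move: p0 | move: q0]; apply: contraTneq => ->; rewrite coef0 meval0 ltxx.
have [[z|p0] _] := zero_or_pos_coef M (size (net_pair mvar M).1).-1.
  by rewrite lead_coefE z eqxx in l1.
have [_ [z|q0]] := zero_or_pos_coef M (size (net_pair mvar M).2).-1.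
  by rewrite lead_coefE z eqxx in l2.
by split; [exact: p0 | exact: q0].
Qed.

Local Notation toF := (@tofrac D).

Lemma toF_inj : injective toF.
Proof. by move=> a b /eqP; rewrite tofrac_eq => /eqP. Qed.

Definition frac_pair M := net_pair (toF \o mvar) M.

Lemma frac_pairE M : frac_pair M =
  (map_poly toF (net_pair mvar M).1, map_poly toF (net_pair mvar M).2).
Proof. exact: map_net_pair. Qed.

(* Scaling the dashpots of [A] moves the zeros of the polynomials of [A] but not
   those of the polynomials of [B]. *)
Lemma coprime_frac_pair A B : ~~ has (mem (params A)) (params B) ->
  coprimep (drop_poly (zero_pole A) (frac_pair A).1)
           (drop_poly (zero_pole B) (frac_pair B).1) /\
  coprimep (frac_pair A).2 (frac_pair B).2.
Proof.
move=> disj; pose one (p : 'I_N + 'I_K) : R := 1.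
have one0 p : 0 < one p by exact: ltr01.
(* [pick] selects the polynomial under consideration. It is polymorphic in the ring, since it is
   applied over polynomials in the parameters, over their fractions and over [R]. *)
have main (pick : forall S : comNzRingType, bool -> {poly S} * {poly S} -> {poly S}) :
  (forall (S S' : comNzRingType) (f : {rmorphism S -> S'}) b P Q,
      map_poly f (pick _ b (P, Q)) = pick _ b (map_poly f P, map_poly f Q)) ->
  (forall M, (pick _ (zero_pole M) (net_pair one M))`_0 != 0) ->
  (forall M theta, (forall i, 0 < theta i) ->
      meval theta (lead_coef (pick _ (zero_pole M) (net_pair mvar M))) != 0) ->
  (forall M (t : R), t != 0 -> exists2 k : R, k != 0 &
     pick _ (zero_pole M) (net_pair (fun p => if p is inr _ then t * one p else one p) M) =
     k%:P * (pick _ (zero_pole M) (net_pair one M) \Po (t%:P * 'X))) ->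
  coprimep (pick _ (zero_pole A) (frac_pair A)) (pick _ (zero_pole B) (frac_pair B)).
  move=> pick_map pick0 pick_lead pick_scale.
  pose q := pick _ (zero_pole B) (net_pair one B).
  pose p := pick _ (zero_pole A) (net_pair one A).
  have [t t0 cop] : exists2 t : R, 0 < t & coprimep (p \Po (t%:P * 'X)) q.
    by apply: coprimep_scale; rewrite horner_coef0; exact: pick0.
  (* All parameters are 1 except the dashpots of [A], which are [t]; coprimality at this one point
     gives generic coprimality. *)
  pose v p := if p \in params A then if p is inr _ then t * one p else one p else one p.
  pose theta i := v (fintype.split i).
  have theta0 i : 0 < theta i.
    rewrite /theta /v; case: ifP => // _.
    by case: (fintype.split i) => // j; rewrite mulr_gt0.
  have vE : valuation theta = v by apply/funext => x; rewrite /valuation /theta unsplitK.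
  rewrite !frac_pairE -!pick_map.
  apply: (coprimep_specialize (f := meval theta)) => //; first exact: toF_inj.
  - by rewrite -surjective_pairing; exact: pick_lead.
  - by rewrite -surjective_pairing; exact: pick_lead.
  rewrite !pick_map.
  have [k k0 ek] := pick_scale A t (lt0r_neq0 t0).
  have eA : pick _ (zero_pole A) (net_pair (valuation theta) A) = k%:P * (p \Po (t%:P * 'X)).
    rewrite vE -ek; congr pick; apply: depends_on_compliance => x xA.
    by rewrite /v xA.
  have eB : pick _ (zero_pole B) (net_pair (valuation theta) B) = q.
    rewrite vE /q; congr pick; apply: depends_on_compliance => x xB.
    rewrite /v ifN //; apply: contra disj => xA; apply/hasP; by exists x.
  rewrite !mvar_eval in eA eB; rewrite eA eB mul_polyC.
  by rewrite coprimepZl.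
split.
- apply: (main (fun S b e => drop_poly b e.1)).
  + by move=> S S' f b P Q; exact: map_drop_poly.
  + move=> M; rewrite coef_drop_poly add0n gt_eqF //.
    by have [] := net_pair_low_coef_gt0 one0 M.
  + move=> M theta h; have [l0 _] := eval_lead_coef M h.
    suff -> : lead_coef (drop_poly (zero_pole M) (net_pair mvar M).1) =
              lead_coef (net_pair mvar M).1 by rewrite gt_eqF.
    case: (boolP (zero_pole M)) => [zM|_]; last by rewrite drop_poly0l.
    by rewrite -[in RHS](mulX_drop (net_pair_coef0 mvar zM)) mulrC lead_coefMX.
  + move=> M t t0; have [k k0 ->] := net_pair_scale one M t0.
    rewrite /= drop_polyCM; case: (boolP (zero_pole M)) => [zM|_]; last first.
      by exists k; rewrite ?drop_poly0l.
    (* The factor [x] that is dropped had been scaled to [t x]. *)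
    exists (k * t); first by rewrite mulf_neq0.
    rewrite -{1}(mulX_drop (net_pair_coef0 one zM)) comp_polyM comp_polyX.
    have -> (r : {poly R}) : t%:P * 'X * r = 'X * (t%:P * r) by ring.
    by rewrite drop_poly1X polyCM mulrA.
- apply: (main (fun S _ e => e.2)) => //.
  + by move=> M; rewrite gt_eqF //; have [] := net_pair_low_coef_gt0 one0 M.
  + by move=> M theta h; rewrite gt_eqF //; have [] := eval_lead_coef M h.
  + by move=> M t t0; have [k k0 ->] := net_pair_scale one M t0; exists k.
Qed.

End ConstitutivePair.

(** * Coefficients and fibers *)

Section CoefficientMap.
Local Open Scope ring_scope.
Variables (R : realType) (N K : nat).
Implicit Types A B M : network N K.

Local Notation D := (mpoly (N + K) R).
Local Notation F := {fraction D}.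
Local Notation toF := (@tofrac D).

Lemma frac_pair_low_coef M : (drop_poly (zero_pole M) (frac_pair R M).1)`_0 != 0.
Proof.
rewrite coef_drop_poly frac_pairE coef_map /= tofrac_eq0.
have [] := net_pair_low_coef_gt0 (v := valuation (fun=> 1 : R)) (fun=> ltr01) M.
by rewrite mvar_eval coef_map /= => + _; apply: contraTneq => ->; rewrite meval0 ltxx.
Qed.

(** By generic coprimality each gcd is associated to 1 or [x], which is what [net_pair] removes. *)
Lemma constitutive_pair M : is_network M ->
  proportional (constitutive R M) (frac_pair R M).
Proof.
elim: M => [j _|k _|A IHA B IHB nw|A IHA B IHB nw].
- exact: proportional_refl.
- by rewrite /frac_pair /= mul_polyC; exact: proportional_refl.
- have [nwA nwB disj] := @network_disjoint N K A B nw.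
  have [_ cop] := coprime_frac_pair R disj.
  have := parallel_remove_gcd (IHA nwA) (IHB nwB) cop.
  rewrite [constitutive R (Par A B)]/=.
  by case: (constitutive R A) => ? ?; case: (constitutive R B) => ? ?.
have [nwA nwB disj] := @network_disjoint N K A B nw.
have [cop _] := coprime_frac_pair R disj.
have := series_remove_gcd (IHA nwA) (IHB nwB) (@net_pair_coef0 _ _ _ _ A)
  (@net_pair_coef0 _ _ _ _ B) (frac_pair_low_coef A) (frac_pair_low_coef B) cop.
rewrite [constitutive R (Ser A B)]/=.
by case: (constitutive R A) => ? ?; case: (constitutive R B) => ? ?.
Qed.

(** Cross-multiplication shows that all admissible representations give the same value, so [xget]
    returns it. *)
Lemma frac_eval_ratio n (theta : n.-tuple R) (p q : mpoly n R) :
  meval (tnth theta) q != 0 ->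
  frac_eval theta (tofrac p / tofrac q) =
  meval (tnth theta) p / meval (tnth theta) q.
Proof.
move=> q0; apply: xget_unique; first by exists p, q.
move=> _ [p' [q' [q'0 e ->]]].
have fq (r : mpoly n R) : meval (tnth theta) r != 0 -> tofrac r != 0.
  by rewrite tofrac_eq0; apply: contraNneq => ->; rewrite meval0.
have /eqP : p * q' = p' * q.
  apply/eqP; rewrite -tofrac_eq !tofracM; apply/eqP.
  by move: e => /eqP; rewrite eqr_div ?fq // => /eqP.
move=> /eqP/(congr1 (meval (tnth theta))); rewrite !mevalM => e'.
by apply/eqP; rewrite eqr_div // e'.
Qed.

(** Normalization divides by the leading coefficient [m], which is positive on [Theta]; equal
    normalized coefficients mean that the pairs differ by the ratio of the two values of [m]. *)
Lemma coef_mapE (s : side) M (theta theta' : (N + K).-tuple R) : is_network M ->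
  Theta theta -> Theta theta' ->
  Defs.coef_map s M theta' = Defs.coef_map s M theta <->
  proportional (compliance M (valuation (tnth theta')))
               (compliance M (valuation (tnth theta))).
Proof.
move=> nw h h'.
pose PQ := net_pair (@mvar R N K) M.
pose A := if s is Strain then PQ.1 else PQ.2.
pose B := if s is Strain then PQ.2 else PQ.1.
pose m : D := lead_coef A.
have m0 th : Theta th -> 0 < meval (tnth th) m.
  by move=> /(eval_lead_coef M)[l1 l2]; rewrite /m /A; case: (s).
have mF : toF m != 0.
  by rewrite tofrac_eq0; apply: contraTneq (m0 _ h) => ->; rewrite meval0 ltxx.
have [nA nB] : on_side s (normalized R s M) = (toF m)^-1 *: map_poly toF A /\
               off_side s (normalized R s M) = (toF m)^-1 *: map_poly toF B.
  have [k k0 e] := constitutive_pair nw; rewrite frac_pairE -/PQ in e.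
  have -> : normalized R s M =
      ((toF m)^-1 *: map_poly toF PQ.1, (toF m)^-1 *: map_poly toF PQ.2).
    rewrite /normalized e.
    have -> : lead_coef (on_side s (k%:P * map_poly toF PQ.1, k%:P * map_poly toF PQ.2)) =
        k * toF m.
      rewrite /m /A; case: (s); rewrite /= mul_polyC lead_coefZ;
      by rewrite lead_coef_map_inj //; exact: toF_inj.
    by rewrite !mul_polyC !scalerA invfM mulrAC mulVf // mul1r.
  by rewrite /A /B; case: (s).
have coefF (C : {poly D}) i : ((toF m)^-1 *: map_poly toF C)`_i = toF C`_i / toF m.
  by rewrite coefZ coef_map mulrC.
have cE (C : {poly D}) th i : Theta th ->
    frac_eval th (((toF m)^-1 *: map_poly toF C)`_i) =
    meval (tnth th) C`_i / meval (tnth th) m.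
  move=> hth; rewrite coefF.
  by rewrite frac_eval_ratio // gt_eqF // m0.
have compE th : compliance M (valuation (tnth th)) =
    (map_poly (meval (tnth th)) PQ.1, map_poly (meval (tnth th)) PQ.2).
  by rewrite /compliance mvar_eval.
pose ratio (C : {poly D}) th i := meval (tnth th) C`_i / meval (tnth th) m.
have ratioP : Defs.coef_map s M theta' = Defs.coef_map s M theta <->
    (forall i, ratio A theta' i = ratio A theta i) /\
    (forall i, ratio B theta' i = ratio B theta i).
  pose L := nonmonic_coefs R s M.
  have LE : L = [seq a <- take (size ((toF m)^-1 *: map_poly toF A)).-1
      ((toF m)^-1 *: map_poly toF A) ++ (toF m)^-1 *: map_poly toF B | a != 0].
    by rewrite /L /nonmonic_coefs nA nB.
  have szA : size ((toF m)^-1 *: map_poly toF A) = size A.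
    by rewrite size_scale ?invr_eq0 // size_map_inj_poly ?rmorph0 //; exact: toF_inj.
  rewrite szA in LE.
  have sideP : Defs.coef_map s M theta' = Defs.coef_map s M theta <->
      {in L, frac_eval theta' =1 frac_eval theta}.
    split=> [/(congr1 val)/= e|e]; first exact/eq_in_map.
    by apply: val_inj => /=; exact/eq_in_map.
  apply: (iff_trans sideP); split=> [e|[eA eB] a].
    have zero (C : {poly D}) i : C`_i = 0 -> ratio C theta' i = ratio C theta i.
      by move=> C0; rewrite /ratio C0 !meval0 !mul0r.
    have nz (C : {poly D}) i : C`_i != 0 -> ((toF m)^-1 *: map_poly toF C)`_i != 0.
      move=> C0; rewrite coefF; apply: mulf_neq0; last by rewrite invr_eq0.
      by rewrite tofrac_eq0.
    split=> i.
      have [/zero //|A0] := eqVneq A`_i 0.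
      have iA : (i < size A)%N.
        by rewrite ltnNge; apply: contra A0 => /(nth_default 0)->.
      (* The monic coefficient is absent from the list, but its ratio is 1 at both points. *)
      move: (iA); rewrite -{1}(ltn_predK iA) ltnS leq_eqVlt => /predU1P[->|{}iA].
        by rewrite /ratio -lead_coefE !divff // gt_eqF // m0.
      rewrite /ratio -!cE //; apply: e; rewrite LE mem_filter nz // mem_cat.
      by rewrite -(nth_take 0 iA) mem_nth // size_takel // szA leq_pred.
    have [/zero //|B0] := eqVneq B`_i 0.
    rewrite /ratio -!cE //; apply: e; rewrite LE mem_filter nz // mem_cat.
    rewrite mem_nth ?orbT // ltnNge; apply: contra (nz _ _ B0) => le.
    by rewrite nth_default.
  rewrite LE mem_filter mem_cat => /andP[_ /orP[/mem_take|]] /(nthP 0)[i _ <-].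
    by rewrite !cE //; exact: eA.
  by rewrite !cE //; exact: eB.
apply: (iff_trans ratioP).
have m1 := lt0r_neq0 (m0 _ h); have m1' := lt0r_neq0 (m0 _ h').
split=> [[eA eB]|].
  have pE (C : {poly D}) : (forall i, ratio C theta' i = ratio C theta i) ->
      map_poly (meval (tnth theta')) C =
      (meval (tnth theta') m / meval (tnth theta) m)%:P * map_poly (meval (tnth theta)) C.
    move=> e; apply/polyP => i; rewrite coefCM !coef_map /=.
    have := e i; rewrite /ratio => /(canRL (divfK m1')) ->.
    by rewrite mulrC mulrCA mulrC.
  exists (meval (tnth theta') m / meval (tnth theta) m).
    by rewrite mulf_neq0 ?invr_eq0.
  rewrite !compE /=; move: (pE _ eA) (pE _ eB); rewrite /A /B.
  by case: (s) => -> ->.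
case=> k k0; rewrite !compE /= => -[e1 e2].
have kE (C : {poly D}) i : map_poly (meval (tnth theta')) C =
    k%:P * map_poly (meval (tnth theta)) C ->
    meval (tnth theta') C`_i = k * meval (tnth theta) C`_i.
  by move=> /(congr1 (fun p : {poly R} => p`_i)); rewrite coefCM !coef_map.
have eA : map_poly (meval (tnth theta')) A = k%:P * map_poly (meval (tnth theta)) A.
  by rewrite /A; case: (s).
have eB : map_poly (meval (tnth theta')) B = k%:P * map_poly (meval (tnth theta)) B.
  by rewrite /B; case: (s).
have km : meval (tnth theta') m = k * meval (tnth theta) m by exact: kE.
by split=> i; rewrite /ratio (kE _ _ eA, kE _ _ eB) km -mulf_div divff // mul1r.
Qed.

End CoefficientMap.

(** * The positive orthant is not negligible *)

Section Measure.
Local Open Scope classical_set_scope.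
Local Open Scope ereal_scope.
Variable R : realType.

Lemma lebesgue_tuple_ge0 n (A : set (n.-tuple (measurableTypeR R))) :
  0 <= lebesgue_tuple A.
Proof.
elim: n A => [|n IH] A; first exact: measure_ge0.
by apply: integral_ge0 => x _; exact: IH.
Qed.

(** For x in (0, 1) the section again contains a positive orthant, so its measure is at least 1 by
    induction. The integral, a supremum over simple functions, dominates that of the indicator of
    (0, 1). *)
Lemma lebesgue_tuple_ge1 n (A : set (n.-tuple (measurableTypeR R))) :
  (forall theta : n.-tuple R, (forall i, (0 < tnth theta i)%R) -> A theta) ->
  1 <= lebesgue_tuple A.
Proof.
elim: n A => [|n IH] A hA.
  rewrite /= diracE mem_set //; apply: hA; by case.
pose f (x : R) := lebesgue_tuple (xsection
  ((fun xt : measurableTypeR R * n.-tuple (measurableTypeR R) =>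
      cons_tuple xt.1 xt.2) @^-1` A) x).
have f1 x : x \in `]0%R, 1%R[%classic -> 1 <= f x.
  rewrite inE /= in_itv /= => /andP[x0 _]; apply: IH => theta h.
  rewrite /xsection /= inE /=; apply: hA => i.
  case: (unliftP ord0 i) => [j|] ->; last by rewrite tnth0.
  by rewrite tnthS.
have : lebesgue_measure (`]0%R, 1%R[%classic : set R) <= \int[@lebesgue_measure R]_x f x.
  rewrite ge0_integralTE; last by move=> x; exact: lebesgue_tuple_ge0.
  have mI : measurable (`]0%R, 1%R[%classic : set (measurableTypeR R)).
    exact: measurable_itv.
  rewrite -sintegral_indic //.
  apply: ereal_sup_ubound; exists (@indic_nnsfun _ (measurableTypeR R) R _ mI) => // x /=.
  rewrite measurable_realfun.mindicE; case: (boolP (x \in _)) => [xI|_]; first exact: f1.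
  exact: lebesgue_tuple_ge0.
by rewrite lebesgue_measure_itv /= lte01 oppr0 adde0.
Qed.

Lemma ae_Theta_witness n (P : n.-tuple R -> Prop) :
  {ae @lebesgue_tuple R n, forall theta, (forall i, (0 < tnth theta i)%R) -> P theta} ->
  exists2 theta : n.-tuple R, forall i, (0 < tnth theta i)%R & P theta.
Proof.
move=> [A [_ A0 PA]]; apply: contrapT => noP.
have : 1 <= lebesgue_tuple A.
  apply: lebesgue_tuple_ge1 => theta h; apply: PA => /= /(_ h) Pt.
  by apply: noP; exists theta.
by rewrite A0 lee_fin ler10.
Qed.

End Measure.

(** * From ambiguity of compliances to fibers of the coefficient map *)

Section Fibers.
Local Open Scope classical_set_scope.
Local Open Scope ring_scope.
Variables (R : realType) (N K : nat).
Implicit Types (M : network N K) (v w : 'I_N + 'I_K -> R).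
Implicit Types (theta : (N + K).-tuple R).

Definition tuple_of v : (N + K).-tuple R :=
  [tuple v (fintype.split i) | i < N + K].

Lemma valuation_tuple_of v : valuation (tnth (tuple_of v)) = v.
Proof. by apply/funext => p; rewrite /valuation tnth_mktuple unsplitK. Qed.

Lemma tuple_of_valuation theta : tuple_of (valuation (tnth theta)) = theta.
Proof. by apply: eq_from_tnth => i; rewrite tnth_mktuple /valuation splitK. Qed.

Lemma fiber_tuple_of s M theta w : is_network M -> Theta theta -> positive w ->
  proportional (compliance M w) (compliance M (valuation (tnth theta))) ->
  fiber s M theta (tuple_of w).
Proof.
move=> nw h w0 p; have hw : Theta (tuple_of w).
  by move=> i; rewrite tnth_mktuple; exact: w0.
by split=> //; apply/(coef_mapE s nw h hw); rewrite valuation_tuple_of.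
Qed.

Lemma ae_weaken n (P Q : n.-tuple R -> Prop) : (forall t, P t -> Q t) ->
  {ae @lebesgue_tuple R n, forall t, P t} ->
  {ae @lebesgue_tuple R n, forall t, Q t}.
Proof.
move=> PQ [A [mA A0 PA]]; exists A; split=> // t nQ; apply: PA => Pt.
by apply: nQ; exact: PQ.
Qed.

Lemma ambiguous_fiber s M theta : is_network M -> ambiguous (params M) (@compliance R N K M) ->
  Theta theta -> fiber s M theta <> [set theta].
Proof.
move=> nw amb h e.
have [|w [w0 _ pw] wv] := amb (valuation (tnth theta)); first by move=> p; exact: h.
apply: wv; rewrite -[w]valuation_tuple_of; congr (valuation (tnth _)).
have : fiber s M theta (tuple_of w) by exact: fiber_tuple_of.
by rewrite e.
Qed.

(** The injective sequence of twins embeds the natural numbers into the fiber. *)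
Lemma infinitely_ambiguous_fiber s M theta : is_network M ->
  infinitely_ambiguous (params M) (@compliance R N K M) -> Theta theta ->
  ~ finite_set (fiber s M theta).
Proof.
move=> nw amb h fin.
have [|w iw tw] := amb (valuation (tnth theta)); first by move=> p; exact: h.
have : finite_set ((tuple_of \o w) @^-1` fiber s M theta).
  apply: finite_preimage fin => i j _ _ /= e; apply: iw.
  by rewrite -[LHS]valuation_tuple_of e valuation_tuple_of.
have -> : (tuple_of \o w) @^-1` fiber s M theta = setT.
  apply/seteqP; split=> // k _ /=; have [wk _ pk] := tw k.
  exact: fiber_tuple_of.
exact: infinite_nat.
Qed.

(** Every parameter occurs in [M], so agreement on [params M] is equality of points. *)
Lemma universal_fiber s M theta n a z : is_network M ->
  (forall p, p \in params M) -> universal (params M) (@compliance R N K M) n a z ->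
  Theta theta -> fiber s M theta = [set theta].
Proof.
move=> nw all_params U h; apply/seteqP; split=> [theta' [h' e]|_ ->]; last by split.
have vE : {in params M, valuation (tnth theta') =1 valuation (tnth theta)}.
  apply: (universal_inj U) => [p|p|]; [exact: h' | exact: h |].
  exact: (coef_mapE s nw h h').1 e.
suff -> : theta' = theta by [].
rewrite -[theta']tuple_of_valuation -[theta]tuple_of_valuation; congr tuple_of.
by apply/funext => p; exact: vE.
Qed.

End Fibers.

Theorem theorem6 (R : realType) (N K : nat) (M : network N K) (s : side)
    (hM : is_network M)
    (hparams : forall p : 'I_N + 'I_K, p \in params M) :
  globally_identifiable R s M <->
  (locally_identifiable R s M /\ one_at_a_time M).
Proof.
split=> [glob|[loc /(universal_or_infinitely_ambiguous R)[[n [a U]]|amb]]].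
- split.
    by apply: ae_weaken glob => theta fib h; rewrite fib.
  have [[n [a [_ _ //]]]|amb] := ambiguous_or_one_at_a_time R hM.
  (* A single point with a singleton fiber already contradicts ambiguity, which holds at every
     point. *)
  have [theta h fib] := ae_Theta_witness glob.
  by case: (ambiguous_fiber hM amb h fib).
- by apply: ae_weaken loc => theta _; exact: universal_fiber U.
have [theta h fib] := ae_Theta_witness loc.
by case: (infinitely_ambiguous_fiber hM amb h fib).
Qed.
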